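(* Let $S$ be a complete semiring, $(\mathbf{C},\otimes,I)$ a small strict monoidal category, $\mathcal{F}$ a system of fields and $\mathbb{T}$ a system of $\mathbf{C}$-valued action exponentials. For every bordism $W$, the state sum $Z_W\in E(\partial W)$ solves the constraint equation: $Z_W(\phi^*f)=Z_W(f)$ for all $f\in\mathcal{F}(\partial W)$ and all homeomorphisms $\phi:\partial W\to\partial W$ isotopic to the identity. Thus $Z_W$ lies in the state module $Z(\partial W)\subset E(\partial W)$.
   Context: A semiring $(S,+,\cdot,0,1)$ consists of a commutative monoid $(S,+,0)$ and a (not necessarily commutative) monoid $(S,\cdot,1)$ such that $\cdot$ distributes over $+$ from both sides and $0$ is absorbing. A complete monoid is a commutative monoid $(M,+,0)$ with a summation law assigning to every family $(m_i)_{i\in I}$, $I$ an arbitrary set, an element $\sum_{i\in I}m_i$ such that $\sum_{i\in\varnothing}m_i=0$, $\sum_{i\in\{1\}}m_i=m_1$, $\sum_{i\in\{1,2\}}m_i=m_1+m_2$, and $\sum_{j\in J}\big(\sum_{i\in I_j}m_i\big)=\sum_{i\in I}m_i$ for every partition $I=\bigcup_{j\in J}I_j$. A semiring is complete if $(S,+,0,\sum)$ is a complete monoid and $\sum_i ss_i=s\sum_i s_i$, $\sum_i s_is=(\sum_i s_i)s$. $Q=Q_S(\mathbf{C})$ is the complete monoid of functions $\operatorname{Mor}(\mathbf{C})\to S$ with pointwise addition and summation. Fix an integer $n\ge 0$. Manifolds are topological and need not be orientable; $\varnothing$ is a manifold of every dimension; $\sqcup$ is the ordered disjoint union. A bordism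 from $M$ to $N$ is a triple $(W,M,N)$ (often abbreviated $W$) with $W$ a compact $(n+1)$-dimensional topological manifold, $\partial W=M\sqcup N$, where the closed $n$-manifolds $M,N$ are the incoming and outgoing boundary. $(W,M,N)\sqcup(W',M',N')=(W\sqcup W',M\sqcup M',N\sqcup N')$. If $W'$ is a bordism from $M$ to $N$ and $W''$ a bordism from $N$ to $P$, gluing along $N$ yields the bordism $W'\cup_N W''$ from $M$ to $P$. A homeomorphism of bordisms is a homeomorphism preserving incoming and outgoing boundaries. $(W_0,M_0,N_0)$ is a subbordism of $(W,M,N)$ if $W_0\subset W$ is a codimension $0$ submanifold, every connected component $C$ of $M_0$ satisfies $C\cap\partial W=\varnothing$ or $C\subset M$, and every connected component $C$ of $N_0$ satisfies $C\cap\partial W=\varnothing$ or $C\subset N$. A system $\mathcal{F}$ of fields assigns to each bordism $W$ a set $\mathcal{F}(W)$ and to each closed $n$-manifold $M$ a set $\mathcal{F}(M)$, with $\mathcal{F}(\varnothing)$ a one-element set, such that: (FRES) There are restriction maps $\mathcal{F}(W)\to\mathcal{F}(W_0)$ for subbordisms $W_0\subset W$, $\mathcal{F}(M)\to\mathcal{F}(M_0)$ for codimension $0$ submanifolds $M_0\subset M$, and $\mathcal{F}(W)\to\mathcal{F}(M)$ for closed codimension $1$ submanifolds $M\subset W$; they are written $f\mapsto f|_{(-)}$ and commute with each other in the obvious way (restricting in stages equals restricting directly). (FHOMEO) A homeomorphism of bordisms $\phi:W\to W'$ induces a bijection $\phi^*:\mathcal{F}(W')\to\mathcal{F}(W)$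 with $(\operatorname{id}_W)^*=\operatorname{id}$, $(\psi\circ\phi)^*=\phi^*\circ\psi^*$; similarly for homeomorphisms of closed $n$-manifolds; these maps commute with the restriction maps. (FDISJ) The products of restrictions $\mathcal{F}(W\sqcup W')\to\mathcal{F}(W)\times\mathcal{F}(W')$ and $\mathcal{F}(M\sqcup N)\to\mathcal{F}(M)\times\mathcal{F}(N)$ are bijections. (FGLUE) For $W=W'\cup_N W''$, the map $\mathcal{F}(W)\to\mathcal{F}(W')\times_{\mathcal{F}(N)}\mathcal{F}(W'')$ given by the restrictions to $W'$ and $W''$ is a bijection onto the pullback. A system $\mathbb{T}$ of $\mathbf{C}$-valued action exponentials consists of functions $\mathbb{T}_W:\mathcal{F}(W)\to\operatorname{Mor}(\mathbf{C})$ for all bordisms $W$ with $\mathbb{T}_\varnothing(p)=\operatorname{id}_I$ ($p$ the unique element of $\mathcal{F}(\varnothing)$) such that: (TDISJ) $\mathbb{T}_{W\sqcup W'}(f)=\mathbb{T}_W(f|_W)\otimes\mathbb{T}_{W'}(f|_{W'})$; (TGLUE) for $W=W'\cup_NW''$, $\mathbb{T}_W(f)=\mathbb{T}_{W''}(f|_{W''})\circ\mathbb{T}_{W'}(f|_{W'})$; (THOMEO) for a homeomorphism of bordisms $\phi:W\to W'$ and $f\in\mathcal{F}(W')$, $\mathbb{T}_W(\phi^*f)=\mathbb{T}_{W'}(f)$. For a closed $n$-manifold $M$, the pre-state module is $E(M)=\operatorname{Fun}_Q(\mathcal{F}(M))$, the set of functions $\mathcal{F}(M)\to Q$, and the state module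 is $Z(M)=\{z\in E(M)\mid z(\phi^*f)=z(f)$ for all $f\in\mathcal{F}(M)$ and all homeomorphisms $\phi:M\to M$ isotopic to the identity$\}$ (an isotopy is a homotopy through homeomorphisms). For a bordism $W$ and $F\in\mathcal{F}(W)$, $T_W(F)\in Q$ is the characteristic function of the morphism $\mathbb{T}_W(F)$ (value $1\in S$ at $\mathbb{T}_W(F)$, $0$ elsewhere). For $f\in\mathcal{F}(\partial W)$ let $\mathcal{F}(W,f)=\{F\in\mathcal{F}(W)\mid F|_{\partial W}=f\}$. The state sum $Z_W\in E(\partial W)$ is $Z_W(f)=\sum_{F\in\mathcal{F}(W,f)}T_W(F)\in Q$, using the summation law of $Q$. *)

(* Defs.v *)
From HB Require Import structures.
From mathcomp Require Import all_boot all_order all_algebra.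
From mathcomp Require Import mathcomp_extra boolp classical_sets functions.
From mathcomp Require Import cardinality reals topology normedtype.

Set Implicit Arguments.
Unset Strict Implicit.
Unset Printing Implicit Defensive.

Import Order.TTheory GRing.Theory Num.Theory.
Import numFieldNormedType.Exports.

Local Open Scope classical_set_scope.
Local Open Scope ring_scope.

(* Families are indexed by arbitrary types.  The indexing sets {1} and {1, 2}
   stand for arbitrary one- and two-element types, and the blocks [B j] of a
   partition of the index type are allowed to be empty. *)
HB.mixin Record Nmodule_isComplete M of GRing.Nmodule M := {
  csum : forall I : Type, (I -> M) -> M;
  csum_empty : forall (I : Type) (m : I -> M), (I -> False) -> csum I m = 0;
  csum_single : forall (I : Type) (m : I -> M) (i : I),
    (forall k, k = i) -> csum I m = m i;
  csum_pair : forall (I : Type) (m : I -> M) (i j : I),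
    i <> j -> (forall k, k = i \/ k = j) -> csum I m = m i + m j;
  csum_partition : forall (I J : Type) (B : J -> set I) (m : I -> M),
    trivIset [set: J] B -> \bigcup_j B j = [set: I] ->
    csum J (fun j => csum (B j) (fun i => m (set_val i))) = csum I m
}.

#[short(type="completeMonoidType")]
HB.structure Definition CompleteMonoid :=
  {M of GRing.Nmodule M & Nmodule_isComplete M}.

Arguments csum {s} {I} m : rename.

HB.mixin Record PzSemiRing_isComplete S
    of GRing.PzSemiRing S & Nmodule_isComplete S := {
  csumZl : forall (I : Type) (s : S) (m : I -> S),
    csum (fun i => s * m i) = s * csum m;
  csumZr : forall (I : Type) (s : S) (m : I -> S),
    csum (fun i => m i * s) = csum m * s
}.

#[short(type="completeSemiRingType")]
HB.structure Definition CompleteSemiRing :=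
  {S of GRing.PzSemiRing S & CompleteMonoid S & PzSemiRing_isComplete S}.

Section FunctionCompleteMonoid.
Variables (X : Type) (M : completeMonoidType).

Definition fct_csum (I : Type) (m : I -> X -> M) : X -> M :=
  fun x => csum (fun i => m i x).

Lemma fct_csum_empty (I : Type) (m : I -> X -> M) :
  (I -> False) -> fct_csum m = 0.
Proof. by move=> I0; apply/funext => x; exact: csum_empty. Qed.

Lemma fct_csum_single (I : Type) (m : I -> X -> M) (i : I) :
  (forall k, k = i) -> fct_csum m = m i.
Proof.
by move=> Ii; apply/funext => x; exact: csum_single.
Qed.

Lemma fct_csum_pair (I : Type) (m : I -> X -> M) (i j : I) :
  i <> j -> (forall k, k = i \/ k = j) -> fct_csum m = m i + m j.
Proof.
by move=> ij Iij; apply/funext => x; exact: csum_pair.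
Qed.

Lemma fct_csum_partition (I J : Type) (B : J -> set I) (m : I -> X -> M) :
  trivIset [set: J] B -> \bigcup_j B j = [set: I] ->
  fct_csum (fun j => fct_csum (fun i : B j => m (set_val i))) = fct_csum m.
Proof.
by move=> tB cB; apply/funext => x; exact: csum_partition.
Qed.

HB.instance Definition _ := Nmodule_isComplete.Build (X -> M)
  fct_csum_empty fct_csum_single fct_csum_pair fct_csum_partition.

End FunctionCompleteMonoid.

(* A single type of morphisms, so that the strict associativity and unit laws
   are equations between morphisms without transport along equalities of
   objects.  [mcomp g f _] is the composite g o f. *)
Record strictMonCat := StrictMonCat {
  mob : Type;
  mmor : Type;
  mdom : mmor -> mob;
  mcod : mmor -> mob;
  mid : mob -> mmor;
  mcomp : forall g f : mmor, mcod f = mdom g -> mmor;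
  mdom_id : forall a, mdom (mid a) = a;
  mcod_id : forall a, mcod (mid a) = a;
  mdom_comp : forall g f (h : mcod f = mdom g), mdom (mcomp h) = mdom f;
  mcod_comp : forall g f (h : mcod f = mdom g), mcod (mcomp h) = mcod g;
  mcomp_idl : forall a f (h : mcod f = mdom (mid a)), mcomp h = f;
  mcomp_idr : forall a g (h : mcod (mid a) = mdom g), mcomp h = g;
  mcompA : forall k g f (hgf : mcod f = mdom g) (hkg : mcod g = mdom k)
      (hl : mcod f = mdom (mcomp hkg)) (hr : mcod (mcomp hgf) = mdom k),
    mcomp hl = mcomp hr;
  munit : mob;
  mtens_ob : mob -> mob -> mob;
  mtens : mmor -> mmor -> mmor;
  mdom_tens : forall f g, mdom (mtens f g) = mtens_ob (mdom f) (mdom g);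
  mcod_tens : forall f g, mcod (mtens f g) = mtens_ob (mcod f) (mcod g);
  mtens_id : forall a b, mtens (mid a) (mid b) = mid (mtens_ob a b);
  mtens_comp : forall g f g' f' (h : mcod f = mdom g) (h' : mcod f' = mdom g')
      (ht : mcod (mtens f f') = mdom (mtens g g')),
    mtens (mcomp h) (mcomp h') = mcomp ht;
  mtens_obA : forall a b c,
    mtens_ob a (mtens_ob b c) = mtens_ob (mtens_ob a b) c;
  mtens_ob1l : forall a, mtens_ob munit a = a;
  mtens_ob1r : forall a, mtens_ob a munit = a;
  mtensA : forall f g h, mtens f (mtens g h) = mtens (mtens f g) h;
  mtens1l : forall f, mtens (mid munit) f = f;
  mtens1r : forall f, mtens f (mid munit) = f
}.

Definition homeomorphism (X Y : topologicalType) (f : X -> Y) : Prop :=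
  exists g : Y -> X,
    [/\ cancel f g, cancel g f, continuous f & continuous g].

Definition top_embedding (X Y : topologicalType) (f : X -> Y) : Prop :=
  injective f /\
  forall A : set X, open A <-> exists2 B : set Y, open B & A = f @^-1` B.

Section Manifolds.
Context {R : realType}.

(* [phi] restricts to a homeomorphism from the open set [U] onto a relatively
   open subset of the model space [H]; outside [U] its values are junk. *)
Definition chart (T : topologicalType) (k : nat) (H : set 'rV[R]_k)
    (U : set T) (phi : T -> 'rV[R]_k) : Prop :=
  [/\ open U, {in U, continuous phi}, {in U &, injective phi} &
    forall A : set T, open A -> A `<=` U ->
      exists2 V : set 'rV[R]_k, open V & phi @` A = V `&` H].

Definition half_space (n : nat) : set 'rV[R]_n.+1 := [set v | 0 <= v 0 0].

Definition locally_modelled (T : topologicalType) (k : nat)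
    (H : set 'rV[R]_k) : Prop :=
  forall x : T, exists (U : set T) (phi : T -> 'rV[R]_k), U x /\ chart H U phi.

Definition is_closed_manifold (n : nat) (T : topologicalType) : Prop :=
  [/\ hausdorff_space T, @second_countable T, compact [set: T] &
    locally_modelled T [set: 'rV[R]_n]].

Definition is_compact_bd_manifold (n : nat) (T : topologicalType) : Prop :=
  [/\ hausdorff_space T, @second_countable T, compact [set: T] &
    locally_modelled T (@half_space n)].

Definition mfd_interior (k : nat) (T : topologicalType) : set T :=
  [set x | exists (U : set T) (phi : T -> 'rV[R]_k),
     U x /\ chart [set: 'rV[R]_k] U phi].

Definition mfd_boundary (k : nat) (T : topologicalType) : set T :=
  ~` @mfd_interior k T.

End Manifolds.

Arguments mfd_interior : clear implicits.
Arguments mfd_boundary : clear implicits.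

Record closedManifold (R : realType) (n : nat) := ClosedManifold {
  cmfd_space :> topologicalType;
  cmfd_closed : @is_closed_manifold R n cmfd_space
}.

Record bordism (R : realType) (n : nat) := Bordism {
  bord_space :> topologicalType;
  bord_mfd : @is_compact_bd_manifold R n bord_space;
  bord_in : set bord_space;
  bord_out : set bord_space;
  bord_in_closed : @is_closed_manifold R n (set_type bord_in);
  bord_out_closed : @is_closed_manifold R n (set_type bord_out);
  bord_bdE : bord_in `|` bord_out = mfd_boundary R n.+1 bord_space;
  bord_in_out : bord_in `&` bord_out = set0
}.

Arguments bord_in {R n} b.
Arguments bord_out {R n} b.

Section Subtypes.
Variables (T : topologicalType) (A : set T).

Lemma open_set_val_preimage (B : set T) :
  open B -> open (@set_val T A @^-1` B).
Proof. by move=> oB; exists B. Qed.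

Lemma set_val_continuous : continuous (@set_val T A).
Proof. by apply/continuousP => B; exact: open_set_val_preimage. Qed.

Lemma set_val_top_embedding : top_embedding (@set_val T A).
Proof.
split; first exact: val_inj.
move=> B; split; first by case=> C oC <-; exists C.
by case=> C oC ->; exact: open_set_val_preimage.
Qed.

Lemma range_set_val : range (@set_val T A) = A.
Proof.
apply/seteqP; split=> [_ [x _ <-]|x Ax]; first exact: set_valP.
by exists (SigSub (mem_set Ax)).
Qed.

Lemma hausdorff_set_type : hausdorff_space T -> hausdorff_space (set_type A).
Proof.
move=> hT p q cl; apply: val_inj; apply: hT => C D nC nD.
have [x [Cx Dx]] := cl _ _ (set_val_continuous nC) (set_val_continuous nD).
by exists (set_val x).
Qed.

Lemma second_countable_set_type :
  @second_countable T -> @second_countable (set_type A).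
Proof.
move=> [B cB [oB bB]]; exists [set set_val @^-1` C | C in B].
  exact: sub_countable (card_image_le _ _) cB.
split=> [_ [C BC <-]|x D [_ [[C oC <-] Cx sD]]].
  exact/open_set_val_preimage/oB.
have [E [BE Ex] sE] := bB _ _ (open_nbhs_nbhs (conj oC Cx)).
exists (set_val @^-1` E); first by split=> //; exists E.
by move=> y Ey; apply: sD; exact: sE.
Qed.

Lemma compact_set_type : compact A -> compact [set: set_type A].
Proof.
move=> cA F FF _; pose G : set_system T := fmap (@set_val T A) F.
have GA : G A.
  rewrite /G /fmap /=; apply: filterS (@filterT _ F _) => x _.
  exact: set_valP.
have [p [Ap clp]] := cA G _ GA.
exists (SigSub (mem_set Ap)); split=> // C D FC [_ [[E oE <-] Ep sD]].
have GC : G (set_val @` C).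
  by rewrite /G /fmap /=; apply: filterS FC => x Cx; exists x.
have [_ [[x Cx <-] Ex]] := clp _ _ GC (open_nbhs_nbhs (conj oE Ep)).
by exists x; split=> //; exact: sD.
Qed.

Lemma compact_of_set_type : compact [set: set_type A] -> compact A.
Proof.
move=> cT; rewrite -range_set_val; apply: continuous_compact => //.
by apply: continuous_subspaceT; exact: set_val_continuous.
Qed.

End Subtypes.

Section Boundary.
Context {R : realType} {n : nat}.
Implicit Type W : bordism R n.

Definition bd_set W : set W := mfd_boundary R n.+1 W.
Arguments bd_set W : clear implicits.

Lemma closed_bd_set W : closed (bd_set W).
Proof.
apply: open_closedC; rewrite openE => x [U [phi [Ux ch]]].
have [oU _ _ _] := ch.
rewrite /interior nbhsE; exists U => // y Uy; by exists U, phi.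
Qed.

Lemma locally_modelled_clopen (T : topologicalType) (A B : set T) (k : nat)
    (x : set_type (A `|` B)) :
  closed B -> A `&` B = set0 -> A (set_val x) ->
  locally_modelled (set_type A) [set: 'rV[R]_k] ->
  exists (U : set (set_type (A `|` B))) (phi : _ -> 'rV[R]_k),
    U x /\ chart [set: 'rV[R]_k] U phi.
Proof.
move=> cB AB0 Ax /(_ (SigSub (mem_set Ax))) [U [phi [Ux]]].
case=> [[U' oU' U'E] cphi iphi ophi].
have AnB y : A y -> ~ B y by move=> Ay By; rewrite -[False]/(set0 y) -AB0.
pose tr (y : set_type (A `|` B)) : set_type A :=
  odflt (SigSub (mem_set Ax)) (insub (set_val y)).
have trE y : ~ B (set_val y) -> set_val (tr y) = set_val y.
  move=> nBy;
  have [Ay|//] : (A `|` B) (set_val y) by exact: set_valP.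
  by rewrite /tr; case: insubP => [u _ //|]; rewrite (mem_set Ay).
have UE a : U a = U' (set_val a) by rewrite -U'E.
pose oD (E : set T) : set (set_type (A `|` B)) := set_val @^-1` (E `&` ~` B).
have ooD E : open E -> open (oD E).
  move=> oE; apply: open_set_val_preimage; apply: openI => //.
  exact: closed_openC.
exists (oD U'), (phi \o tr); split.
  by split; [move: Ux; rewrite UE | exact: AnB].
split.
- exact: ooD.
- move=> y /set_mem [U'y nBy].
  apply: (@continuous_comp _ _ _ tr phi).
    move=> D [_ [[E oE <-] Ey sD]].
    have Ey' : oD E y by split=> //; move: Ey; rewrite /= trE.
    apply: filterS (open_nbhs_nbhs (conj (ooD _ oE) Ey')) => z [Ez nBz].
    by apply: sD; rewrite /= trE.
  by apply: cphi; apply: mem_set; rewrite UE trE.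
- move=> y z /set_mem [U'y nBy] /set_mem [U'z nBz] /= e.
  apply: val_inj; rewrite -[LHS]trE // -[RHS]trE //; congr set_val.
  by apply: iphi e; apply: mem_set; rewrite UE trE.
- move=> D [E oE DE] sD.
  have oD1 : open (set_val @^-1` E `&` U : set (set_type A)).
    by apply: openI; [exact: open_set_val_preimage | exists U'].
  have [V oV VE] := ophi _ oD1 (@subIsetr _ _ _).
  exists V => //; rewrite -VE; apply/seteqP; split.
    move=> _ [y Dy <-]; have [U'y nBy] := sD _ Dy.
    exists (tr y) => //; split; last by rewrite UE trE.
    by rewrite /= trE //; move: Dy; rewrite -DE.
  move=> _ [a [Ea Ua] <-].
  have Aa : A (set_val a) by exact: set_valP.
  have ABa : (A `|` B) (set_val a) by left.
  exists (SigSub (mem_set ABa)); first by rewrite -DE.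
  by rewrite /=; congr phi; apply: val_inj; apply: trE; exact: AnB.
Qed.

Lemma bd_is_closed_manifold W : @is_closed_manifold R n (set_type (bd_set W)).
Proof.
have [hW sW cW _] := bord_mfd W.
have [_ _ /compact_of_set_type ci mi] := bord_in_closed W.
have [_ _ /compact_of_set_type co mo] := bord_out_closed W.
split.
- exact: hausdorff_set_type.
- exact: second_countable_set_type.
- apply: compact_set_type; apply: subclosed_compact cW _ => //.
  exact: closed_bd_set.
- rewrite /bd_set -bord_bdE => x.
  have [inx|outx] : (bord_in W `|` bord_out W) (set_val x) by exact: set_valP.
    apply: locally_modelled_clopen => //; last exact: bord_in_out.
    exact: compact_closed.
  move: x outx; rewrite setUC => x outx.
  apply: locally_modelled_clopen => //; last by rewrite setIC bord_in_out.
  exact: compact_closed.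
Qed.

Definition bd_mfd W : closedManifold R n :=
  ClosedManifold (bd_is_closed_manifold W).

Definition bd_incl W : bd_mfd W -> W := @set_val W (bd_set W).

End Boundary.

Arguments bd_set {R n} W.
Arguments bd_incl {R n} W.

(* A submanifold is represented by an embedding with that image; a subset with
   its subspace topology is the case of [set_val].  Submanifolds are taken to
   be locally flat. *)

Section Maps.
Context {R : realType} {n : nat}.
Implicit Types (M N : closedManifold R n) (W : bordism R n).

Definition codim0_submanifold M0 M (i : M0 -> M) : Prop :=
  top_embedding i /\ open (range i).

(* Near a point of its image a codimension 1 submanifold either is a hyperplane
   in a Euclidean chart, or coincides with the boundary of [W]. *)
Definition codim1_submanifold M W (j : M -> W) : Prop :=
  top_embedding j /\
  forall p : M,
    (exists (U : set W) (phi : W -> 'rV[R]_n.+1),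
      [/\ U (j p), chart [set: 'rV[R]_n.+1] U phi &
          U `&` range j = U `&` [set y | phi y 0 0 = 0]]) \/
    (\forall y \near j p, range j y <-> bd_set W y).

(* The conditions on boundary components in [subbordism] exclude corners: near
   a point of its image, [W0] is all of [W] or a half-space in a Euclidean
   chart. *)
Definition codim0_bd_submanifold W0 W (i : W0 -> W) : Prop :=
  top_embedding i /\
  forall p : W0,
    nbhs (i p) (range i) \/
    exists (U : set W) (phi : W -> 'rV[R]_n.+1),
      [/\ U (i p), chart [set: 'rV[R]_n.+1] U phi &
          U `&` range i = U `&` [set y | 0 <= phi y 0 0]].

Definition subbordism W0 W (i : W0 -> W) : Prop :=
  [/\ codim0_bd_submanifold i,
    forall x, bord_in W0 x ->
      let C := i @` connected_component (bord_in W0) x in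
      C `&` bd_set W = set0 \/ C `<=` bord_in W &
    forall x, bord_out W0 x ->
      let C := i @` connected_component (bord_out W0) x in
      C `&` bd_set W = set0 \/ C `<=` bord_out W].

Definition bord_homeomorphism W W' (phi : W -> W') : Prop :=
  [/\ homeomorphism phi, phi @` bord_in W = bord_in W' &
      phi @` bord_out W = bord_out W'].

Definition isotopic_to_id (X : topologicalType) (phi : X -> X) : Prop :=
  exists h : R -> X -> X,
    [/\ {within [set tx : R * X | 0 <= tx.1 <= 1],
          continuous (fun tx => h tx.1 tx.2)},
        forall t, 0 <= t <= 1 -> homeomorphism (h t),
        h 0 = id & h 1 = phi].

(* [M] is the disjoint union of [M1] and [M2] along [i1], [i2], in this
   order.  Disjoint unions and gluings are thereby specified up to
   homeomorphism. *)
Record is_disjoint_union M1 M2 M (i1 : M1 -> M) (i2 : M2 -> M) : Prop := {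
  disj_subl : codim0_submanifold i1;
  disj_subr : codim0_submanifold i2;
  disj_cover : range i1 `|` range i2 = [set: M];
  disj_meet : range i1 `&` range i2 = set0
}.

Record is_bord_disjoint_union W1 W2 W (i1 : W1 -> W) (i2 : W2 -> W) : Prop := {
  bdisj_subl : subbordism i1;
  bdisj_subr : subbordism i2;
  bdisj_cover : range i1 `|` range i2 = [set: W];
  bdisj_meet : range i1 `&` range i2 = set0;
  bdisj_in : bord_in W = i1 @` bord_in W1 `|` i2 @` bord_in W2;
  bdisj_out : bord_out W = i1 @` bord_out W1 `|` i2 @` bord_out W2
}.

(* [W] is obtained by gluing [W1] and [W2] along [N], embedded by [j1] as the
   outgoing boundary of [W1] and by [j2] as the incoming boundary of [W2]. *)
Record is_gluing N W1 W2 W (j1 : N -> W1) (j2 : N -> W2)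
    (i1 : W1 -> W) (i2 : W2 -> W) : Prop := {
  glue_codim1l : codim1_submanifold j1;
  glue_codim1r : codim1_submanifold j2;
  glue_range_out : range j1 = bord_out W1;
  glue_range_in : range j2 = bord_in W2;
  glue_subl : subbordism i1;
  glue_subr : subbordism i2;
  glue_comm : i1 \o j1 = i2 \o j2;
  glue_cover : range i1 `|` range i2 = [set: W];
  glue_meet : range i1 `&` range i2 = range (i1 \o j1);
  glue_in : bord_in W = i1 @` bord_in W1;
  glue_out : bord_out W = i2 @` bord_out W2
}.

Lemma bd_incl_codim1 W : codim1_submanifold (bd_incl W).
Proof.
split; first exact: set_val_top_embedding.
by move=> p; right; apply: nearW => y; rewrite range_set_val.
Qed.

End Maps.

Arguments isotopic_to_id R {X} phi.

Record fieldSystem (R : realType) (n : nat) := FieldSystem {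
  FW : bordism R n -> Type;
  FM : closedManifold R n -> Type;
  FM_empty : forall M : closedManifold R n,
    (M -> False) -> exists p : FM M, forall f, f = p;
  FW_empty : forall W : bordism R n,
    (W -> False) -> exists p : FW W, forall F, F = p;

  resW : forall (W0 W : bordism R n) (i : W0 -> W),
    subbordism i -> FW W -> FW W0;
  resM : forall (M0 M : closedManifold R n) (i : M0 -> M),
    codim0_submanifold i -> FM M -> FM M0;
  resWM : forall (M : closedManifold R n) (W : bordism R n) (j : M -> W),
    codim1_submanifold j -> FW W -> FM M;
  resW_resW : forall (W1 W0 W : bordism R n) (i1 : W1 -> W0) (i0 : W0 -> W)
      (h1 : subbordism i1) (h0 : subbordism i0) (h : subbordism (i0 \o i1)) F,
    resW h1 (resW h0 F) = resW h F;
  resM_resM : forall (M1 M0 M : closedManifold R n)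
      (i1 : M1 -> M0) (i0 : M0 -> M)
      (h1 : codim0_submanifold i1) (h0 : codim0_submanifold i0)
      (h : codim0_submanifold (i0 \o i1)) f,
    resM h1 (resM h0 f) = resM h f;
  resM_resWM : forall (M0 M : closedManifold R n) (W : bordism R n)
      (i : M0 -> M) (j : M -> W)
      (hi : codim0_submanifold i) (hj : codim1_submanifold j)
      (h : codim1_submanifold (j \o i)) F,
    resM hi (resWM hj F) = resWM h F;
  resWM_resW : forall (M : closedManifold R n) (W0 W : bordism R n)
      (j : M -> W0) (i : W0 -> W)
      (hj : codim1_submanifold j) (hi : subbordism i)
      (h : codim1_submanifold (i \o j)) F,
    resWM hj (resW hi F) = resWM h F;

  pullW : forall (W W' : bordism R n) (phi : W -> W'),
    bord_homeomorphism phi -> FW W' -> FW W;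
  pullM : forall (M M' : closedManifold R n) (phi : M -> M'),
    homeomorphism phi -> FM M' -> FM M;
  pullW_bij : forall (W W' : bordism R n) (phi : W -> W')
      (h : bord_homeomorphism phi),
    bijective (pullW h);
  pullM_bij : forall (M M' : closedManifold R n) (phi : M -> M')
      (h : homeomorphism phi),
    bijective (pullM h);
  pullW_id : forall (W : bordism R n) (h : bord_homeomorphism (@id W)) F,
    pullW h F = F;
  pullM_id : forall (M : closedManifold R n) (h : homeomorphism (@id M)) f,
    pullM h f = f;
  pullW_comp : forall (W W' W'' : bordism R n) (phi : W -> W') (psi : W' -> W'')
      (hphi : bord_homeomorphism phi) (hpsi : bord_homeomorphism psi)
      (h : bord_homeomorphism (psi \o phi)) F,
    pullW h F = pullW hphi (pullW hpsi F);
  pullM_comp : forall (M M' M'' : closedManifold R n)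
      (phi : M -> M') (psi : M' -> M'')
      (hphi : homeomorphism phi) (hpsi : homeomorphism psi)
      (h : homeomorphism (psi \o phi)) f,
    pullM h f = pullM hphi (pullM hpsi f);
  pullW_resW : forall (W0 W W0' W' : bordism R n)
      (i : W0 -> W) (i' : W0' -> W')
      (phi : W -> W') (phi0 : W0 -> W0') (hi : subbordism i)
      (hi' : subbordism i') (h : bord_homeomorphism phi)
      (h0 : bord_homeomorphism phi0),
    phi \o i = i' \o phi0 ->
    forall F, resW hi (pullW h F) = pullW h0 (resW hi' F);
  pullM_resM : forall (M0 M M0' M' : closedManifold R n)
      (i : M0 -> M) (i' : M0' -> M')
      (phi : M -> M') (phi0 : M0 -> M0') (hi : codim0_submanifold i)
      (hi' : codim0_submanifold i') (h : homeomorphism phi)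
      (h0 : homeomorphism phi0),
    phi \o i = i' \o phi0 ->
    forall f, resM hi (pullM h f) = pullM h0 (resM hi' f);
  pull_resWM : forall (M M' : closedManifold R n) (W W' : bordism R n)
      (j : M -> W) (j' : M' -> W')
      (phi : W -> W') (phi0 : M -> M') (hj : codim1_submanifold j)
      (hj' : codim1_submanifold j') (h : bord_homeomorphism phi)
      (h0 : homeomorphism phi0),
    phi \o j = j' \o phi0 ->
    forall F, resWM hj (pullW h F) = pullM h0 (resWM hj' F);

  FW_disj : forall (W1 W2 W : bordism R n) (i1 : W1 -> W) (i2 : W2 -> W)
      (h : is_bord_disjoint_union i1 i2),
    bijective (fun F => (resW (bdisj_subl h) F, resW (bdisj_subr h) F));
  FM_disj : forall (M1 M2 M : closedManifold R n) (i1 : M1 -> M) (i2 : M2 -> M)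
      (h : is_disjoint_union i1 i2),
    bijective (fun f => (resM (disj_subl h) f, resM (disj_subr h) f));

  FW_glue : forall (N : closedManifold R n) (W1 W2 W : bordism R n)
      (j1 : N -> W1) (j2 : N -> W2) (i1 : W1 -> W) (i2 : W2 -> W)
      (h : is_gluing j1 j2 i1 i2) F1 F2,
    resWM (glue_codim1l h) F1 = resWM (glue_codim1r h) F2 ->
    exists! F, resW (glue_subl h) F = F1 /\ resW (glue_subr h) F = F2
}.

Arguments FW {R n} _ W.
Arguments FM {R n} _ M.

(* In [TT_glue] the composability of the two values is part of the axiom. *)
Record actionExponentials (R : realType) (n : nat) (C : strictMonCat)
    (F : fieldSystem R n) := ActionExponentials {
  TT : forall W : bordism R n, FW F W -> mmor C;
  TT_empty : forall (W : bordism R n) (p : FW F W),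
    (W -> False) -> TT p = mid (munit C);
  TT_disj : forall (W1 W2 W : bordism R n) (i1 : W1 -> W) (i2 : W2 -> W)
      (h : is_bord_disjoint_union i1 i2) (f : FW F W),
    TT f = mtens (TT (resW (bdisj_subl h) f)) (TT (resW (bdisj_subr h) f));
  TT_glue : forall (N : closedManifold R n) (W1 W2 W : bordism R n)
      (j1 : N -> W1) (j2 : N -> W2) (i1 : W1 -> W) (i2 : W2 -> W)
      (h : is_gluing j1 j2 i1 i2) (f : FW F W),
    exists c : mcod (TT (resW (glue_subl h) f)) =
               mdom (TT (resW (glue_subr h) f)),
      TT f = mcomp c;
  TT_homeo : forall (W W' : bordism R n) (phi : W -> W')
      (h : bord_homeomorphism phi) (f : FW F W'),
    TT (pullW h f) = TT f
}.

Section States.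
Context (S : completeSemiRingType) (C : strictMonCat) {R : realType} {n : nat}.
Context {F : fieldSystem R n}.

Definition Qmon : completeMonoidType := mmor C -> S.

Definition char_fun (c : mmor C) : Qmon :=
  fun c' => if `[< c' = c >] then 1 else 0.

Definition pre_state_module (M : closedManifold R n) : Type := FM F M -> Qmon.

Definition state_module (M : closedManifold R n) : set (pre_state_module M) :=
  [set z | forall (phi : M -> M) (h : homeomorphism phi),
     isotopic_to_id R phi -> forall f : FM F M, z (pullM h f) = z f].

Definition restrict_bd (W : bordism R n) (G : FW F W) : FM F (bd_mfd W) :=
  resWM (bd_incl_codim1 W) G.

Definition state_sum (T : actionExponentials C F) (W : bordism R n) :
    pre_state_module (bd_mfd W) :=
  fun f => csum (fun G : {G : FW F W | restrict_bd G = f} =>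
    char_fun (TT T (sval G))).

End States.

Arguments pre_state_module S C {R n} F M.
Arguments state_module S C {R n} F M.
Arguments state_sum S {C R n F} T W.

(* Main.v *)
Require Import Defs.
From mathcomp Require Import all_boot all_order all_algebra.
From mathcomp Require Import boolp classical_sets functions reals topology.
From mathcomp Require Import normedtype.
From mathcomp Require Import lra ring.

Set Implicit Arguments.
Unset Strict Implicit.
Unset Printing Implicit Defensive.

Import Order.TTheory GRing.Theory Num.Theory.
Import numFieldNormedType.Exports.

Local Open Scope classical_set_scope.
Local Open Scope ring_scope.

(** The state sum at [f] runs over the fields on [W] that restrict to [f] on
    the boundary.  If the homeomorphism [phi] of the boundary extends to a
    homeomorphism [Phi] of the bordism [W], then pulling back along [Phi] is a
    bijection from the fields restricting to [f] onto those restricting to the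
    pullback of [f] along [phi], and it does not change the action; hence both
    state sums add up the same family ([state_sum_pullM]).  Everything
    therefore rests on extending [phi], and this is where the isotopy [h] from
    the identity to [phi] enters.

    On a collar [B * [0, 1]] of the boundary [B], in which the copy of [B] at
    height 0 is the inner end, one can apply [h t] to the slice at height [t]:
    this is [phi] on the outer end, and the identity on the inner one, so it
    extends by the identity ([isotopy_extension]).  A collar exists by Brown's
    theorem; the proof given here is Connelly's.  One glues an external collar
    to the space and stretches the space over it, one chart at a time.  The
    space with a partial external collar of height [s] is realized as a subset
    [fence B s] of the product with the real line, so that no quotient is
    formed, and [fence_embedding B s Psi] says that the space has been
    stretched over it.  In a chart the stretch is [push], a piecewise linear
    map along the lines transverse to [B]; by compactness finitely many of
    them bring the height to 1 ([fence_embedding1]).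

    The argument needs product neighbourhoods of the boundary points, that is,
    half-space charts whose flat points are exactly the boundary points that
    they cover.  The boundary is defined as the set of points without a
    Euclidean chart, so one has to know that flat points have none.
    Invariance of domain can be bypassed: by translation, if one flat point
    had a Euclidean chart then so would all of them, and the boundary would be
    empty ([flat_interior_transfer]).

    Finally [Phi] respects the incoming and the outgoing boundary, because
    these are open and closed in the boundary and the points of the boundary
    move along the paths of the isotopy ([isotopy_preserves_clopen]). *)

(** * A piecewise linear stretch of the line *)

(** The piecewise linear homeomorphism of the line that fixes everything below
    [- r] and carries [[- r, a]] affinely onto [[- r, b]]. *)
Definition stretch (R : realFieldType) (r a b u : R) : R :=
  u + Num.max 0 (u + r) * ((b - a) / (a + r)).

Lemma stretch_id (R : realFieldType) (r a b u : R) :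
  u <= - r -> stretch r a b u = u.
Proof. by move=> ur; rewrite /stretch max_l ?mul0r ?addr0 //; lra. Qed.

Lemma stretch_same (R : realFieldType) (r a u : R) : stretch r a a u = u.
Proof. by rewrite /stretch subrr mul0r mulr0 addr0. Qed.

Lemma stretchE (R : realFieldType) (r a b u : R) :
  0 < r -> 0 <= a -> - r <= u ->
  stretch r a b u = (u + r) * ((b + r) / (a + r)) - r.
Proof.
move=> r0 a0 ur; rewrite /stretch max_r; last lra.
by field; apply: lt0r_neq0; lra.
Qed.

Lemma stretch_ge (R : realFieldType) (r a b u : R) :
  0 < r -> 0 <= a -> 0 <= b -> - r <= u -> - r <= stretch r a b u.
Proof.
move=> r0 a0 b0 ur; rewrite stretchE // lerBrDl subrr.
by apply: mulr_ge0; [lra | apply: divr_ge0; lra].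
Qed.

Lemma stretchK (R : realFieldType) (r a b u : R) :
  0 < r -> 0 <= a -> 0 <= b -> stretch r b a (stretch r a b u) = u.
Proof.
move=> r0 a0 b0; have [ur|ru] := lerP u (- r).
  by rewrite !stretch_id // stretch_id.
have ge := stretch_ge r0 a0 b0 (ltW ru).
rewrite (stretchE _ r0 b0 ge) (stretchE _ r0 a0 (ltW ru)).
by field; apply/andP; split; apply: lt0r_neq0; lra.
Qed.

Lemma stretch_end (R : realFieldType) (r a b : R) :
  0 < r -> 0 <= a -> stretch r a b a = b.
Proof.
by move=> r0 a0; rewrite stretchE //; [field; apply: lt0r_neq0; lra | lra].
Qed.

Lemma stretch_le (R : realFieldType) (r a b u : R) :
  0 < r -> 0 <= a -> 0 <= b -> u <= a -> stretch r a b u <= b.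
Proof.
move=> r0 a0 b0 ua; have [ur|ru] := lerP u (- r).
  by rewrite stretch_id //; lra.
rewrite stretchE ?(ltW ru)// mulrCA lerBlDr ler_piMr //; first lra.
rewrite ler_pdivrMr; lra.
Qed.

Lemma stretch_continuous (R : realType) (X : topologicalType) (r : R)
    (a b u : X -> R) (x : X) :
  0 < r -> 0 <= a x ->
  {for x, continuous a} -> {for x, continuous b} -> {for x, continuous u} ->
  {for x, continuous (fun y => stretch r (a y) (b y) (u y))}.
Proof.
move=> r0 a0 ca cb cu.
have cmax : {for x, continuous (fun y => Num.max 0 (u y + r))}.
  apply: (@continuous_max _ _ (fun=> 0) (fun y => u y + r)).
    exact: cst_continuous.
  by apply: cvgD => //; exact: cvg_cst.
apply: cvgD => //; apply: cvgM => //.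
apply: cvgM; first exact: cvgB.
apply: cvgV; first by apply: lt0r_neq0; lra.
by apply: cvgD => //; exact: cvg_cst.
Qed.

(** * Stretching along the lines of a collar chart *)

(** The set [O] as the product of [O `&` B] with the half-open interval from 0
    to [rho]: [ht] is the second coordinate, and [sl w c] is the point with the
    first coordinate of [w] and the second coordinate [c].  Stated with these
    two maps, the product structure needs no subspace of [T]. *)
Record collar_chart (R : realType) (T : topologicalType) (B O : set T)
    (rho : R) (ht : T -> R) (sl : T -> R -> T) : Prop := CollarChart {
  collar_rho_gt0 : 0 < rho;
  collar_open : open O;
  ht_continuous : forall w, O w -> {for w, continuous ht};
  ht_ge0 : forall w, O w -> 0 <= ht w;
  ht_lt : forall w, O w -> ht w < rho;
  ht_eq0 : forall w, O w -> ht w = 0 <-> B w;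
  slO : forall w c, O w -> 0 <= c -> c < rho -> O (sl w c);
  ht_sl : forall w c, O w -> 0 <= c -> c < rho -> ht (sl w c) = c;
  sl_sl : forall w c d, O w -> 0 <= c -> c < rho -> 0 <= d -> d < rho ->
    sl (sl w c) d = sl w d;
  sl_ht : forall w, O w -> sl w (ht w) = w;
  sl_continuous : forall w c, O w -> c < rho ->
    {for (w, c), continuous (fun z : T * R => sl z.1 (Num.max 0 z.2))}
}.

(** The space with a partial external collar of height [s] over [B], embedded
    in the product with the line instead of being glued along [B]. *)
Definition fence (R : realType) (T : Type) (B : set T) (s : T -> R) :
    set (T * R) :=
  [set z | z.2 = 0 \/ [/\ B z.1, 0 <= z.2 & z.2 <= s z.1]].

Section Push.
Context {R : realType} {T : topologicalType}.
Variables (B O : set T) (rho : R) (ht : T -> R) (sl : T -> R -> T).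
Hypothesis ch : collar_chart B O rho ht sl.

(** Inside the chart, the fence is a union of lines transverse to [B], one for
    each foot [sl w 0].  On such a line [line] is the coordinate that runs from
    negative values in the space, through 0 on [B], to the positive heights
    of the external collar; [line_point] is the inverse parametrization. *)
Definition line (z : T * R) : R := z.2 - ht z.1.

Definition push_line (s s' : T -> R) (z : T * R) : R :=
  stretch (rho / 2) (s (sl z.1 0)) (s' (sl z.1 0)) (line z).

Definition line_point (w : T) (u : R) : T * R :=
  (sl w (Num.max 0 (- u)), Num.max 0 u).

(** On the line over the foot [b], [push s s'] moves the end of the fence from
    height [s b] to height [s' b]. *)
Definition push (s s' : T -> R) (z : T * R) : T * R :=
  if `[< O z.1 >] then line_point z.1 (push_line s s' z) else z.

Lemma push_in s s' z : O z.1 ->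
  push s s' z = line_point z.1 (push_line s s' z).
Proof. by move=> Oz; rewrite /push asboolT. Qed.

Lemma push_out s s' z : ~ O z.1 -> push s s' z = z.
Proof. by move=> Oz; rewrite /push asboolF. Qed.

Lemma half_rho_gt0 : 0 < rho / 2.
Proof. by rewrite divr_gt0 // (collar_rho_gt0 ch). Qed.

Lemma foot_bd w : O w -> B (sl w 0).
Proof.
move=> Ow; have r0 := collar_rho_gt0 ch.
by apply/(ht_eq0 ch); [exact: (slO ch) | rewrite (ht_sl ch)].
Qed.

Lemma foot_of_bd w : O w -> B w -> sl w 0 = w.
Proof. by move=> Ow /(ht_eq0 ch Ow) h0; rewrite -{2}(sl_ht ch Ow) h0. Qed.

Lemma line_le (s : T -> R) z : (forall w, 0 <= s w) -> O z.1 -> fence B s z ->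
  line z <= s (sl z.1 0).
Proof.
move=> s0 Oz [z0|[Bz z0 zs]]; rewrite /line.
  by rewrite z0 sub0r (le_trans _ (s0 _))// oppr_le0 (ht_ge0 ch).
by rewrite (ht_eq0 ch Oz).2 // subr0 foot_of_bd.
Qed.

Lemma line_gt z : O z.1 -> 0 <= z.2 -> - rho < line z.
Proof. by move=> Oz z0; have := ht_lt ch Oz; rewrite /line; lra. Qed.

Lemma fence_ge0 (s : T -> R) z : fence B s z -> 0 <= z.2.
Proof. by case=> [->//|[]]. Qed.

Lemma line_pointK (s : T -> R) z :
  O z.1 -> fence B s z -> line_point z.1 (line z) = z.
Proof.
move=> Oz Fz; rewrite /line_point /line.
case: z Oz Fz => w t /= Ow [/= ->|/= [Bw t0 _]].
  rewrite sub0r opprK (max_r (ht_ge0 ch Ow)) (sl_ht ch) //.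
  by rewrite max_l // oppr_le0 (ht_ge0 ch).
rewrite (ht_eq0 ch Ow).2 // subr0 (max_r t0) max_l ?oppr_le0 //.
by rewrite foot_of_bd.
Qed.

(** One of the two maxima in [line_point] vanishes; the lower bound on the
    coordinate keeps the other one inside the chart. *)
Lemma line_line_point w u : O w -> - rho < u -> line (line_point w u) = u.
Proof.
move=> Ow ru; rewrite /line /line_point /= (ht_sl ch) //.
- by case: (lerP 0 u) => u0; [rewrite max_l | rewrite max_r]; lra.
- by rewrite le_max lexx.
- by rewrite gt_max (collar_rho_gt0 ch) /=; lra.
Qed.

Section PushFence.
Variables s s' : T -> R.
Hypotheses (s_ge0 : forall w, 0 <= s w) (s'_ge0 : forall w, 0 <= s' w).

Lemma push_line_gt z : O z.1 -> 0 <= z.2 -> - rho < push_line s s' z.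
Proof.
move=> Oz z0; have r0 := half_rho_gt0; rewrite /push_line.
have [lr|rl] := lerP (line z) (- (rho / 2)).
  by rewrite stretch_id //; exact: line_gt.
have := stretch_ge r0 (s_ge0 (sl z.1 0)) (s'_ge0 (sl z.1 0)) (ltW rl).
by lra.
Qed.

Lemma neg_lt_rho u : - rho < u -> Num.max 0 (- u) < rho.
Proof. by move=> ru; rewrite gt_max (collar_rho_gt0 ch) /=; lra. Qed.

Lemma push_O z : O z.1 -> 0 <= z.2 -> O (push s s' z).1.
Proof.
move=> Oz z0; rewrite push_in //; apply: (slO ch) => //.
  by rewrite le_max lexx.
exact/neg_lt_rho/push_line_gt.
Qed.

(** Outside the chart nothing moves, and there the image need not lie in
    [fence B s'] unless [s] and [s'] agree. *)
Lemma push_fence z : fence B s z -> fence B s' (push s s' z) \/ ~ O z.1.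
Proof.
move=> Fz; have [Oz|] := pselect (O z.1); last by right.
left; rewrite push_in //; set u := push_line s s' z.
rewrite /fence /line_point /=; have [u0|u0] := lerP u 0; first by left.
right; rewrite (_ : Num.max 0 (- u) = 0); last by apply: max_l; lra.
split; [exact: foot_bd | exact: ltW |].
by apply: stretch_le => //; [exact: half_rho_gt0 | exact: line_le].
Qed.

Lemma pushK z : fence B s z -> push s' s (push s s' z) = z.
Proof.
move=> Fz; have z0 := fence_ge0 Fz.
have [Oz|nOz] := pselect (O z.1); last by rewrite !push_out // push_out.
have Oz' := push_O Oz z0; rewrite (push_in _ _ Oz') /push_line.
have gt := push_line_gt Oz z0; have r0 := collar_rho_gt0 ch.
rewrite push_in // line_line_point //.
set u := push_line s s' z.
have m0 : 0 <= Num.max 0 (- u) by rewrite le_max lexx.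
have mr : Num.max 0 (- u) < rho by exact: neg_lt_rho.
have foot : sl (sl z.1 (Num.max 0 (- u))) 0 = sl z.1 0 by rewrite (sl_sl ch).
rewrite /line_point /= foot.
have -> : stretch (rho / 2) (s' (sl z.1 0)) (s (sl z.1 0)) u = line z.
  by apply: stretchK => //; exact: half_rho_gt0.
rewrite (sl_sl ch) //; first exact: (line_pointK Oz Fz).
  by rewrite le_max lexx.
exact/neg_lt_rho/line_gt.
Qed.

End PushFence.

(** Continuity holds along maps into the fence only: off the fence the point
    does not lie on its line, and [push] may jump at the frontier of the chart.
    On the fence, the points that move lie over a compact subset of [O],
    since the stretch is the identity below [- (rho / 2)] and on the lines
    where [s] and [s'] agree. *)
Lemma push_continuous (X : topologicalType) (f : X -> T * R) (s s' : T -> R)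
    (E : set T) :
  compact E -> hausdorff_space T ->
  closed B ->
  (forall w, 0 <= s w) -> (forall w, 0 <= s' w) ->
  continuous s -> continuous s' ->
  E `<=` O -> (forall w, ~ E w -> s w = s' w) ->
  continuous f -> (forall x, fence B s (f x)) ->
  continuous (push s s' \o f).
Proof.
move=> cptE hT cB s0 s'0 cs cs' EO ss' cf ff x.
have r0 := half_rho_gt0.
have rr : rho / 2 < rho by have := collar_rho_gt0 ch; lra.
(* Every point of the fence that moves lies over [D]. *)
pose D := (fun z : T * R => sl z.1 (Num.max 0 z.2)) @`
  ((E `&` B) `*` `[0, rho / 2]).
have DO : D `<=` O.
  move=> y [[w c] [[/= Ew _]]] /=; rewrite in_itv /= => /andP[c0 cr] <-.
  by apply: (slO ch); [exact: EO | rewrite le_max lexx | rewrite max_r //; lra].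
have cD : closed D.
  apply: compact_closed => //; apply: continuous_compact; last first.
    apply: compact_setX; last exact: segment_compact.
    exact: compact_closedI.
  rewrite continuous_subspace_in => y /set_mem Ay.
  apply: continuous_subspaceT_for => //; case: y Ay => w c /= [[/= Ew _]].
  rewrite in_itv /= => /andP[c0 cr].
  by apply: (sl_continuous ch); [exact: EO | lra].
have stay z : fence B s z -> O z.1 -> ~ D z.1 -> push s s' z = z.
  move=> Fz Oz nDz; rewrite push_in // -[RHS](line_pointK Oz Fz).
  congr line_point; rewrite /push_line.
  have [/ss' ->|/contrapT Ez] := pselect (~ E (sl z.1 0)).
    exact: stretch_same.
  apply: stretch_id; rewrite leNgt; apply/negP => lr; apply: nDz.
  have hz : ht z.1 < rho / 2.
    case: Fz => [z0|[Bz _ _]]; last by rewrite (ht_eq0 ch Oz).2.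
    by move: lr; rewrite /line z0; lra.
  have h0 := ht_ge0 ch Oz; have h1 := ht_lt ch Oz.
  exists (sl z.1 0, ht z.1); first split => /=.
  - by split => //; exact: foot_bd.
  - by rewrite in_itv /= h0 ltW.
  - by rewrite /= max_r // (sl_sl ch) // ?(sl_ht ch) ?(collar_rho_gt0 ch).
have cf1 y : {for y, continuous (fun x => (f x).1)}.
  by apply: continuous_comp; [exact: cf | exact: cvg_fst].
have cf2 y : {for y, continuous (fun x => (f x).2)}.
  by apply: continuous_comp; [exact: cf | exact: cvg_snd].
have [Ox|nOx] := pselect (O (f x).1); last first.
  have nDx : ~ D (f x).1 by move=> /DO.
  rewrite /continuous_at /= push_out //.
  apply: (@cvg_trans _ (f y @[y --> x])); last exact: cf.
  apply: near_eq_cvg.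
  have /cf1 : nbhs (f x).1 (~` D).
    by apply: open_nbhs_nbhs; split => //; exact: closed_openC.
  rewrite /nbhs /= /fmap /=; apply: filterS => y nDy /=.
  have [Oy|nOy] := pselect (O (f y).1); first by rewrite stay.
  by rewrite push_out.
have nOx : \forall y \near x, O (f y).1.
  by apply: cf1; apply: open_nbhs_nbhs; split => //; exact: (collar_open ch).
have fx0 := fence_ge0 (ff x).
have csl (c : X -> R) : c x < rho -> {for x, continuous c} ->
    {for x, continuous (fun y => sl (f y).1 (Num.max 0 (c y)))}.
  move=> cr cc; apply: (@continuous_comp _ _ _ (fun y => ((f y).1, c y))
    (fun z : T * R => sl z.1 (Num.max 0 z.2)) x).
    exact: (cvg_pair (cf1 x) cc).
  exact: (sl_continuous ch).
have cfoot : {for x, continuous (fun y => sl (f y).1 0)}.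
  have := csl (fun=> 0) (collar_rho_gt0 ch) (@cst_continuous _ _ _ _).
  by rewrite maxxx.
have cline : {for x, continuous (fun y => line (f y))}.
  apply: cvgB; first exact: cf2.
  by apply: continuous_comp; [exact: cf1 | exact: (ht_continuous ch)].
have cpl : {for x, continuous (fun y => push_line s s' (f y))}.
  apply: stretch_continuous => //; try exact: s0.
  - by apply: continuous_comp; [exact: cfoot | exact: cs].
  - by apply: continuous_comp; [exact: cfoot | exact: cs'].
have gt := push_line_gt s0 s'0 Ox fx0.
rewrite /continuous_at /= push_in //.
apply: (@cvg_trans _
    (line_point (f y).1 (push_line s s' (f y)) @[y --> x])).
  apply: near_eq_cvg; apply: filterS nOx => y Oy /=; rewrite push_in //.
have c1 := csl (fun y => - push_line s s' (f y)) _ (cvgN cpl).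
have c2 : {for x, continuous (fun y => Num.max 0 (push_line s s' (f y)))}.
  by apply: (@continuous_max _ _ (fun=> 0)) => //; exact: cst_continuous.
have nr : - push_line s s' (f x) < rho by lra.
exact: (cvg_pair (c1 nr _) c2).
Qed.

End Push.

(** * Absorbing an external collar *)

(** The space stretched homeomorphically over its external collar, with [B]
    carried to the outer end. *)
Definition fence_embedding (R : realType) (T : topologicalType) (B : set T)
    (s : T -> R) (Psi : T -> T * R) : Prop :=
  [/\ continuous Psi, injective Psi, range Psi = fence B s &
      forall b, B b -> Psi b = (b, s b)].

Lemma fence_embedding0 (R : realType) (T : topologicalType) (B : set T) :
  fence_embedding B (fun=> 0) (fun w : T => (w, 0 : R)).
Proof.
split=> //.
- by move=> w; exact: (cvg_pair cvg_id (cvg_cst _)).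
- by move=> v w [].
- apply/seteqP; split=> [_ [w _ <-]|]; first by left.
  move=> [w t] [/= ->|/= [_ t0 t1]]; first by exists w.
  by exists w => //; congr pair; apply/le_anti; rewrite t0.
Qed.

Section Collar.
Context {R : realType} {T : topologicalType}.
Variable B : set T.
Hypotheses (hT : hausdorff_space T) (cptT : compact [set: T]) (cB : closed B).

Lemma closed_compact (A : set T) : closed A -> compact A.
Proof. by move=> cA; apply: subclosed_compact cA cptT _. Qed.

(** One stretch changes the height of the fence from [s] to [s'] over a closed
    part of a chart.  Bijectivity comes from [pushK]: exchanging [s] and [s']
    gives the inverse. *)
Lemma fence_embedding_push (O : set T) (rho : R) (ht : T -> R)
    (sl : T -> R -> T) (s s' : T -> R) (E : set T) (Psi : T -> T * R) :
  collar_chart B O rho ht sl ->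
  (forall w, 0 <= s w) -> (forall w, 0 <= s' w) ->
  continuous s -> continuous s' ->
  closed E -> E `<=` O -> (forall w, ~ E w -> s w = s' w) ->
  fence_embedding B s Psi ->
  fence_embedding B s' (push O rho ht sl s s' \o Psi).
Proof.
move=> ch s0 s'0 cs cs' cE EO ss' [cPsi iPsi rPsi bPsi].
have FPsi w : fence B s (Psi w) by rewrite -rPsi; exists w.
have EE w : ~ O w -> ~ E w by move=> nO /EO.
have push_sub (r r' : T -> R) z :
    (forall w, 0 <= r w) -> (forall w, 0 <= r' w) ->
    (forall w, ~ E w -> r w = r' w) -> fence B r z ->
    fence B r' (push O rho ht sl r r' z).
  move=> r0 r'0 rr' Fz; have [//|nO] := push_fence ch r0 r'0 Fz.
  rewrite push_out //; case: Fz => [z0|[Bz z0 zr]]; [by left | right].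
  by rewrite -rr' //; exact: EE.
split.
- by apply: (push_continuous ch _ _ _ _ _ _ _ EO) => //; exact: closed_compact.
- move=> v w /= e; apply: iPsi.
  by rewrite -(pushK ch s0 s'0 (FPsi v)) e (pushK ch s0 s'0 (FPsi w)).
- apply/seteqP; split=> [_ [w _ <-]|z Fz]; first exact: push_sub.
  have := push_sub s' s z s'0 s0 (fun w nE => esym (ss' w nE)) Fz.
  rewrite -rPsi => -[w _ e]; exists w => //=.
  by rewrite e (pushK ch s'0 s0 Fz).
- move=> b Bb /=; rewrite bPsi //.
  have [Ob|nOb] := pselect (O b); last by rewrite push_out // ss' //; exact: EE.
  rewrite push_in // /push_line /line /= (ht_eq0 ch Ob).2 // subr0.
  rewrite (foot_of_bd ch Ob Bb) stretch_end //; last exact: half_rho_gt0 ch.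
  by rewrite /line_point max_l ?oppr_le0 // (foot_of_bd ch Ob Bb) max_r.
Qed.

(** The fence can be raised to height 1 over [N] within a single chart: [beta]
    is the height to be reached, and its support stays inside the chart. *)
Definition raisable (N : set T) : Prop :=
  exists (O : set T) (rho : R) (ht : T -> R) (sl : T -> R -> T) (E : set T)
    (beta : T -> R),
  [/\ collar_chart B O rho ht sl, closed E, E `<=` O & continuous beta] /\
  [/\ forall w, beta w <= 1, forall w, ~ E w -> beta w = 0 &
      forall w, N w -> beta w = 1].

Lemma collar_chart_raisable (O : set T) (rho : R) (ht : T -> R)
    (sl : T -> R -> T) (x : T) :
  collar_chart B O rho ht sl -> O x -> exists N, [/\ open N, N x & raisable N].
Proof.
move=> ch Ox; have oO := collar_open ch.
have sep : uniform_separator [set x] (~` O).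
  apply: (normal_uniform_separator (compact_normal hT cptT)).
  - by apply: compact_closed => //; exact: compact_set1.
  - exact: open_closedC.
  - by apply/seteqP; split=> // y [-> /(_ Ox)].
have [f [cf _ f0 f1]] := (@uniform_separatorP _ R _ _).1 sep.
(* [f] is known to be 0 only at [x] and to be 1 only off [O]; clipping makes
   [beta] constant where [f <= 1 / 4] and where [f >= 1 / 2]. *)
pose beta w : R := Num.max 0 (Num.min 1 (2 - 4 * f w)).
exists [set w | f w < 4^-1]; split.
- rewrite (_ : [set w | _] = f @^-1` [set t | t < 4^-1]) //.
  by apply: open_comp => [w _|]; [exact: cf | exact: open_lt].
- by rewrite /= (_ : f x = 0) ?invr_gt0 //; apply: f0; exists x.
exists O, rho, ht, sl, [set w | f w <= 2^-1], beta; split; split => //.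
- rewrite (_ : [set w | _] = f @^-1` [set t | t <= 2^-1]) //.
  by apply: preimage_closed => [w _|]; [exact: cf | exact: closed_le].
- move=> w /= fw; apply: contrapT => nOw.
  by have : f w = 1 by [apply: f1; exists w]; lra.
- move=> w; have cl : {for w, continuous (fun w => 2 - 4 * f w)}.
    apply: cvgB; first exact: cvg_cst.
    by apply: cvgM; [exact: cvg_cst | exact: cf].
  have cm : {for w, continuous (fun w => Num.min 1 (2 - 4 * f w))}.
    by apply: (@continuous_min _ _ (fun=> 1)) => //; exact: cst_continuous.
  by apply: (@continuous_max _ _ (fun=> 0)) cm; exact: cst_continuous.
- by move=> w; rewrite /beta ge_max ler01 ge_min lexx.
- move=> w /= /negP; rewrite -ltNge => fw; rewrite /beta max_l //.
  by rewrite ge_min; apply/orP; right; lra.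
- by move=> w /= fw; rewrite /beta min_l ?max_r //; lra.
Qed.

(** Taking the maximum of [s] and [beta] never lowers the fence, so what has
    been raised to height 1 stays there. *)
Lemma fence_embedding_raise (l : seq (set T)) :
  exists (s : T -> R) (Psi : T -> T * R),
  [/\ continuous s, forall w, 0 <= s w <= 1,
      forall N w, List.In N l -> raisable N -> N w -> s w = 1 &
      fence_embedding B s Psi].
Proof.
elim: l => [|N l [s [Psi [cs s01 s1 ePsi]]]].
  exists (fun=> 0), (fun w => (w, 0)); split => //.
  - by move=> w; exact: cvg_cst.
  - by move=> w; rewrite lexx ler01.
  - exact: fence_embedding0.
have [[O [rho [ht [sl [E [beta [[ch cE EO cb] [b1 bE bN]]]]]]]]|nN] :=
    pselect (raisable N); last first.
  exists s, Psi; split => // M w /= [<-//|]; exact: s1.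
pose s' w := Num.max (s w) (beta w).
have s0 w : 0 <= s w by case/andP: (s01 w).
have s'0 w : 0 <= s' w by rewrite le_max s0.
exists s', (push O rho ht sl s s' \o Psi); split.
- by move=> w; apply: continuous_max; [exact: cs | exact: cb].
- by move=> w; rewrite s'0 ge_max b1; case/andP: (s01 w) => _ ->.
- move=> M w /= [<- _ Nw|lM rM Mw]; rewrite /s'.
    by rewrite bN // max_r //; case/andP: (s01 w).
  by rewrite (s1 M) // max_l.
- apply: (fence_embedding_push ch _ _ cs _ cE EO) => //.
    by move=> w; apply: continuous_max; [exact: cs | exact: cb].
  by move=> w nE; rewrite /s' bE // max_l.
Qed.

(** Local collars give a global one, in the form of a homeomorphism of the
    space with the space enlarged by an external collar. *)
Theorem fence_embedding1 :
  (forall x, B x -> exists (O : set T) (rho : R) (ht : T -> R)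
     (sl : T -> R -> T), collar_chart B O rho ht sl /\ O x) ->
  exists Psi : T -> T * R, fence_embedding B (fun=> 1) Psi.
Proof.
move=> Bch.
(* A finite subcover is extracted by taking the near-covering property for the
   filter of all sufficiently large finite lists of sets. *)
pose F : set_system (seq (set T)) := [set A | exists l0, forall l,
  (forall N, List.In N l0 -> List.In N l) -> A l].
have FF : Filter F.
  split=> [|P Q [l0 Pl] [l1 Ql]|P Q PQ [l0 Pl]].
  - by exists [::].
  - exists (l0 ++ l1) => l sl; split; [apply: Pl | apply: Ql] => N lN.
      by apply/sl/List.in_or_app; left.
    by apply/sl/List.in_or_app; right.
  - by exists l0 => l /Pl /PQ.
pose P l y := exists N, [/\ List.In N l, raisable N & N y].
have [|l0 /(_ l0 (fun N => id)) Bl] :=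
    (compact_near_coveringP B).1 (closed_compact cB) _ F P FF.
  move=> x /Bch [O [rho [ht [sl [ch Ox]]]]].
  have [N [oN Nx rN]] := collar_chart_raisable ch Ox.
  exists (N, [set l | List.In N l]).
    split => /=; first exact: open_nbhs_nbhs.
    by exists [:: N] => l; apply; left.
  by move=> [y l] /= [Ny lN]; exists N.
have [s [Psi [_ _ s1 [cPsi iPsi rPsi bPsi]]]] := fence_embedding_raise l0.
have sB w : B w -> s w = 1 by move=> /Bl [N [lN rN Nw]]; exact: (s1 N).
exists Psi; split => //; last by move=> b Bb; rewrite bPsi // sB.
rewrite rPsi; apply/seteqP; split=> z [z0|[Bz z0 z1]]; try by left.
  by right; split => //; rewrite -(sB _ Bz).
by right; split => //; rewrite (sB _ Bz).
Qed.

End Collar.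

(** * Extending an isotopy of a collared subset *)

Lemma hausdorff_prod (T U : topologicalType) :
  hausdorff_space T -> hausdorff_space U -> hausdorff_space (T * U)%type.
Proof.
move=> hT hU [p1 p2] [q1 q2] cl; congr pair.
  apply: hT => C D nC nD.
  have [||z [Cz Dz]] := cl ((fun z => z.1) @^-1` C) ((fun z => z.1) @^-1` D).
  - exact: (@cvg_fst _ _ (nbhs p1) (nbhs p2)).
  - exact: (@cvg_fst _ _ (nbhs q1) (nbhs q2)).
  - by exists z.1.
apply: hU => C D nC nD.
have [||z [Cz Dz]] := cl ((fun z => z.2) @^-1` C) ((fun z => z.2) @^-1` D).
- exact: (@cvg_snd _ _ (nbhs p1) (nbhs p2)).
- exact: (@cvg_snd _ _ (nbhs q1) (nbhs q2)).
- by exists z.2.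
Qed.

(** [Psi] is a closed map, so the factor [Phi] of [q] through it inherits
    continuity; for [q] the identity, this is the continuity of the inverse of
    a continuous bijection. *)
Lemma lift_through_compact (X T Y : topologicalType) (Psi : T -> Y)
    (q : X -> Y) (Phi : X -> T) :
  compact [set: T] -> hausdorff_space Y -> continuous Psi -> injective Psi ->
  continuous q -> (forall x, Psi (Phi x) = q x) -> continuous Phi.
Proof.
move=> cptT hY cPsi iPsi cq PhiE; apply/continuous_closedP => C cC.
have -> : Phi @^-1` C = q @^-1` (Psi @` C).
  apply/seteqP; split=> [x Cx|x [w Cw]]; first by exists (Phi x).
  by rewrite /= -PhiE => /iPsi <-.
apply: preimage_closed => [x _|]; first exact: cq.
apply: compact_closed => //; apply: continuous_compact.
  exact: continuous_subspaceT.
exact: subclosed_compact cC cptT _.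
Qed.

Section Extension.
Context {R : realType} {T : topologicalType}.
Variable B : set T.
Hypothesis cB : closed B.

(** The isotopy spread over the external collar, with time as height. *)
Definition twist (h : R -> set_type B -> set_type B) (z : T * R) : T * R :=
  if pselect (B z.1) is left Bz
  then (set_val (h z.2 (SigSub (mem_set Bz))), z.2) else z.

Lemma twist_in h (b : set_type B) (t : R) :
  twist h (set_val b, t) = (set_val (h t b), t).
Proof.
rewrite /twist /=; case: pselect => [Bb|[]]; last exact: set_valP.
by congr (set_val (h t _), t); apply: val_inj.
Qed.

Lemma twist_out h z : ~ B z.1 -> twist h z = z.
Proof. by rewrite /twist; case: pselect. Qed.

Lemma in_bd (w : T) : B w -> exists b : set_type B, set_val b = w.
Proof. by move=> Bw; exists (SigSub (mem_set Bw)). Qed.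

Variable Psi : T -> T * R.
Hypothesis ePsi : fence_embedding B (fun=> 1) Psi.

(** The fence is the union of two closed pieces: the collar, where [twist] is
    built from the isotopy, and the space itself, where it is the identity;
    they agree on [B] because [h 0 = id]. *)
Lemma twist_continuous (h : R -> set_type B -> set_type B) :
  {within [set tx : R * set_type B | 0 <= tx.1 <= 1],
    continuous (fun tx => h tx.1 tx.2)} ->
  h 0 = id -> continuous (twist h \o Psi).
Proof.
move=> /subspace_continuousP ch h0; have [cPsi iPsi rPsi bPsi] := ePsi.
have FPsi w : fence B (fun=> 1) (Psi w) by rewrite -rPsi; exists w.
have cP1 y : {for y, continuous (fun x => (Psi x).1)}.
  by apply: continuous_comp; [exact: cPsi | exact: cvg_fst].
have cP2 y : {for y, continuous (fun x => (Psi x).2)}.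
  by apply: continuous_comp; [exact: cPsi | exact: cvg_snd].
have P01 w : B (Psi w).1 -> 0 <= (Psi w).2 <= 1.
  by case: (FPsi w) => [->|[_ -> ->//]]; rewrite lexx ler01.
pose A1 := [set w | B (Psi w).1]; pose A2 := [set w | (Psi w).2 = 0].
have AT : A1 `|` A2 = [set: T].
  apply/seteqP; split=> // w _.
  by case: (FPsi w) => [|[]]; [right | left].
suff : {within A1 `|` A2, continuous (twist h \o Psi)}.
  by rewrite AT => c; apply/continuous_subspace_setT.
apply: withinU_continuous.
- rewrite (_ : A1 = (fun x => (Psi x).1) @^-1` B) //.
  by apply: preimage_closed => // w _; exact: cP1.
- rewrite (_ : A2 = (fun x => (Psi x).2) @^-1` [set 0]) //.
  by apply: preimage_closed => [w _|]; [exact: cP2 | exact: closed_eq].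
- apply/subspace_continuousP => x A1x.
  have [b bE] := in_bd A1x.
  have xE : Psi x = (set_val b, (Psi x).2) by rewrite bE -surjective_pairing.
  rewrite /from_subspace /=.
  have -> : twist h (Psi x) = (set_val (h (Psi x).2 b), (Psi x).2).
    by rewrite {1}xE twist_in.
  have c1 : (twist h (Psi y)).1 @[y --> within A1 (nbhs x)] -->
      set_val (h (Psi x).2 b).
    move=> U nU.
    have /ch : [set tx : R * set_type B | 0 <= tx.1 <= 1] ((Psi x).2, b).
      exact: P01.
    move=> /(_ _ (set_val_continuous nU)) [[V1 V2] /= [nV1 nV2] V12].
    case: nV2 => _ [[V oV <-] Vb sV].
    have nVx : nbhs x ((fun x => (Psi x).1) @^-1` V).
      by apply: cP1; apply: open_nbhs_nbhs; split => //; rewrite -bE.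
    change (nbhs x [set y | A1 y -> U (twist h (Psi y)).1]).
    have nVx1 : nbhs x ((fun x => (Psi x).2) @^-1` V1) by exact: cP2.
    apply: filterS (filterI nVx1 nVx) => y [V1y Vy] A1y /=; 
    have [c cE] := in_bd A1y.
    have -> : Psi y = (set_val c, (Psi y).2) by rewrite cE -surjective_pairing.
    rewrite twist_in /=; apply: (V12 ((Psi y).2, c)); last exact: P01.
    by split => //; apply: sV; rewrite /= cE.
  have c2 : (Psi y).2 @[y --> within A1 (nbhs x)] --> (Psi x).2.
    by apply: cvg_within_filter; exact: cP2.
  apply: cvg_trans (cvg_pair c1 c2).
  apply: near_eq_cvg; apply: nearW => y /=; rewrite /twist.
  by case: pselect => [?|?] //=; rewrite -surjective_pairing.
- apply: (@subspace_eq_continuous _ _ _ Psi); last exact: continuous_subspaceT.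
  move=> x /set_mem A2x; rewrite /from_subspace /=.
  have [A1x|nA1x] := pselect (B (Psi x).1).
    have [b bE] := in_bd A1x.
    have xE : Psi x = (set_val b, 0) by rewrite [LHS]surjective_pairing A2x bE.
    by rewrite xE twist_in h0.
  by rewrite twist_out.
Qed.

End Extension.

(** The extension is [twist h] conjugated by the homeomorphism [Psi] onto the
    space with external collar; [Psi] carries [B] to the outer end, where
    [twist h] is [h 1 = phi]. *)
Theorem isotopy_extension (R : realType) (T : topologicalType) (B : set T)
    (phi : set_type B -> set_type B) :
  hausdorff_space T -> compact [set: T] -> closed B ->
  (forall x, B x -> exists (O : set T) (rho : R) (ht : T -> R)
     (sl : T -> R -> T), collar_chart B O rho ht sl /\ O x) ->
  isotopic_to_id R phi ->
  exists Phi : T -> T, homeomorphism Phi /\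
    forall b, Phi (set_val b) = set_val (phi b).
Proof.
move=> hT cptT cB Bch [h [ch hh h0 h1]].
have [Psi ePsi] := fence_embedding1 hT cptT cB Bch.
have [cPsi iPsi rPsi bPsi] := ePsi.
have hTR : hausdorff_space (T * R)%type.
  exact: hausdorff_prod hT (@Rhausdorff R).
have ctw := twist_continuous cB ePsi ch h0.
have FPsi w : fence B (fun=> 1) (Psi w) by rewrite -rPsi; exists w.
have P01 w : B (Psi w).1 -> 0 <= (Psi w).2 <= 1.
  by case: (FPsi w) => [->|[_ -> ->//]]; rewrite lexx ler01.
have hE w : B (Psi w).1 ->
    exists b : set_type B, Psi w = (set_val b, (Psi w).2).
  by move=> /in_bd [b bE]; exists b; rewrite bE -surjective_pairing.
have fence_in (b : set_type B) t :
    0 <= t <= 1 -> exists w, Psi w = (set_val b, t).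
  move=> /andP[t0 t1]; suff : range Psi (set_val b, t).
    by case=> w _ <-; exists w.
  by rewrite rPsi; right; split => //; exact: set_valP.
have /choice [Phi PhiE] w : exists w', Psi w' = twist h (Psi w).
  have [/[dup] /P01 t01 /hE [b bE]|nB] := pselect (B (Psi w).1); last first.
    by exists w; rewrite twist_out.
  by rewrite bE twist_in; exact: fence_in.
have cPhi : continuous Phi.
  exact: lift_through_compact cptT hTR cPsi iPsi ctw PhiE.
have iPhi : injective Phi.
  move=> v w /(congr1 Psi); rewrite !PhiE.
  have [/[dup] /P01 t01 /hE [b bE]|nB] := pselect (B (Psi v).1);
    have [/[dup] /P01 u01 /hE [c cE]|nC] := pselect (B (Psi w).1).
  - rewrite bE cE !twist_in => -[/val_inj + tu]; rewrite -tu.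
    have [g [gK _ _ _]] := hh _ t01.
    by move=> /(can_inj gK) bc; apply: iPsi; rewrite bE cE bc tu.
  - rewrite bE twist_in twist_out // => e; case: nC; rewrite -e.
    exact: set_valP.
  - rewrite cE twist_in twist_out // => e; case: nB; rewrite e.
    exact: set_valP.
  - by rewrite !twist_out // => /iPsi.
have /choice [g gK] w : exists v, Phi v = w.
  have [/[dup] /P01 t01 /hE [b bE]|nB] := pselect (B (Psi w).1); last first.
    by exists w; apply: iPsi; rewrite PhiE twist_out.
  have [k [_ kK _ _]] := hh _ t01.
  have [v vE] := fence_in (k b) _ t01.
  by exists v; apply: iPsi; rewrite PhiE vE twist_in kK.
exists Phi; split.
  exists g; split => //; first by move=> w; apply: iPhi; rewrite gK.
  apply: (@lift_through_compact _ _ _ Phi id) => //.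
  by move=> w; exact: cvg_id.
move=> b; apply: iPsi; rewrite PhiE !bPsi; try exact: set_valP.
by rewrite twist_in h1.
Qed.

(** * Half-space charts and flat points *)

Section Charts.
Context {R : realType} {k : nat}.
Implicit Types (T : topologicalType) (H : set 'rV[R]_k).

Lemma chart_preimage_open T H (U : set T) (phi : T -> 'rV[R]_k)
    (P : set 'rV[R]_k) :
  chart H U phi -> open P -> open (U `&` phi @^-1` P).
Proof.
move=> [oU cphi _ _] oP; rewrite openE => x [Ux Px].
apply: filterI; first exact: open_nbhs_nbhs.
by apply: (cphi x (mem_set Ux)); exact: open_nbhs_nbhs.
Qed.

(** A chart onto a relatively open subset of [H] has a section defined on the
    whole model space, with junk values outside that subset; the last clause is
    continuity of the section relative to [H]. *)
Lemma chart_section T H (U : set T) (phi : T -> 'rV[R]_k) :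
  T -> chart H U phi ->
  exists (psi : 'rV[R]_k -> T) (V : set 'rV[R]_k),
  [/\ open V,
      forall v, V v -> H v -> U (psi v) /\ phi (psi v) = v,
      forall w, U w -> [/\ V (phi w), H (phi w) & psi (phi w) = w] &
      forall v N, V v -> H v -> open N -> N (psi v) ->
        exists V', [/\ open V', V' v & forall u, V' u -> H u -> N (psi u)]].
Proof.
move=> x0 [oU cphi iphi ophi].
have [V oV VE] := ophi _ oU (@subset_refl _ _).
have phiV w : U w -> (V `&` H) (phi w) by move=> Uw; rewrite -VE; exists w.
have /choice [psi psiP] v : exists w, V v -> H v -> U w /\ phi w = v.
  have [[Vv Hv]|nVH] := pselect ((V `&` H) v).
    by move: (conj Vv Hv : (V `&` H) v); rewrite -VE => -[w Uw <-]; exists w.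
  by exists x0 => Vv Hv; case: nVH.
have psiK w : U w -> psi (phi w) = w.
  move=> Uw; have [Vw Hw] := phiV _ Uw; have [Uw' e] := psiP _ Vw Hw.
  by apply: iphi e; exact: mem_set.
exists psi, V; split => //.
  by move=> w Uw; have [] := phiV _ Uw; split => //; exact: psiK.
move=> v N Vv Hv oN Nv; have [Uv phiv] := psiP _ Vv Hv.
have [V' oV' V'E] := ophi _ (openI oN oU) (@subIsetr _ _ _).
exists V'; split => //.
  have : (V' `&` H) v by rewrite -V'E -phiv; exists (psi v).
  by case.
move=> u V'u Hu; have : (V' `&` H) u by split.
by rewrite -V'E => -[w [Nw Uw] <-]; rewrite psiK.
Qed.

End Charts.

Section HalfSpaceCharts.
Context {R : realType} {n : nat}.
Implicit Types T : topologicalType.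
Local Notation V := 'rV[R]_n.+1.

Lemma open_coord0_gt0 : open [set v : V | 0 < v 0 0].
Proof.
rewrite (_ : [set v : V | _] = (fun v : V => v 0 0) @^-1` [set t | 0 < t]) //.
by apply: open_comp => [v _|]; [exact: coord_continuous | exact: open_gt].
Qed.

Lemma half_chart_interior T (U : set T) (phi : T -> V) (x : T) :
  chart (@half_space R n) U phi -> U x -> 0 < phi x 0 0 ->
  mfd_interior R n.+1 T x.
Proof.
move=> ch Ux x0; have [oU cphi iphi ophi] := ch.
exists (U `&` phi @^-1` [set v | 0 < v 0 0]), phi; split => //; split.
- exact: chart_preimage_open ch open_coord0_gt0.
- by move=> y /set_mem [Uy _]; apply: cphi; exact: mem_set.
- move=> y z /set_mem [Uy _] /set_mem [Uz _]; apply: iphi; exact: mem_set.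
- move=> A oA AU.
  have [A' oA' AE] := ophi A oA (subset_trans AU (@subIsetl _ _ _)).
  exists (A' `&` [set v | 0 < v 0 0]); first exact: openI oA' open_coord0_gt0.
  rewrite setIT; apply/seteqP; split => [_ [w Aw <-]|v [A'v v0]].
    split; last by case: (AU _ Aw).
    have : (A' `&` half_space (n:=n)) (phi w) by rewrite -AE; exists w.
    by case.
  by rewrite AE; split => //; exact: ltW.
Qed.

(** Whether a flat point of a half-space chart is an interior point does not
    depend on the point: translations along the boundary hyperplane carry a
    Euclidean chart around one flat point to any other.  Consequently, if some
    flat point lies on the boundary then all of them do. *)
Lemma flat_interior_transfer T1 T2 (U1 : set T1) (U2 : set T2)
    (phi1 : T1 -> V) (phi2 : T2 -> V) (x1 : T1) (x2 : T2) :
  chart (@half_space R n) U1 phi1 -> U1 x1 -> phi1 x1 0 0 = 0 ->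
  chart (@half_space R n) U2 phi2 -> U2 x2 -> phi2 x2 0 0 = 0 ->
  mfd_interior R n.+1 T1 x1 -> mfd_interior R n.+1 T2 x2.
Proof.
move=> ch1 Ux1 a0 ch2 Ux2 b0 [E [e [Ex1 che]]].
have [oE ce ie oe] := che.
have [oU1 c1 i1 o1] := ch1; have [oU2 c2 i2 o2] := ch2.
have [psi [V1 [oV1 psiU psiK cpsi]]] := chart_section x1 ch1.
set a := phi1 x1 in a0; set b := phi2 x2 in b0.
have [V1a Ha psia] := psiK _ Ux1.
have [V' [oV' V'a V'E]] : exists V', [/\ open V', V' a &
    forall u, V' u -> half_space u -> E (psi u)].
  by apply: cpsi => //; rewrite -/a psia.
pose sh (v : V) : V := v - b + a.
have csh : continuous sh.
  by move=> v; exact: (cvgD (cvgB cvg_id (cvg_cst _)) (cvg_cst _)).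
have sh0 v : sh v 0 0 = v 0 0 by rewrite /sh !mxE a0 b0 subr0 addr0.
have Hsh v : half_space v -> half_space (sh v) by rewrite /half_space /= sh0.
have H2 y : U2 y -> half_space (phi2 y).
  move=> U2y; have [A _ AE] := o2 _ oU2 (@subset_refl _ _).
  by have : (A `&` half_space (n:=n)) (phi2 y) by [rewrite -AE; exists y]; case.
(* [tau] translates a neighbourhood of [x2] to one of [x1]; the chart at [x2]
   is [e] read through it. *)
pose tau y := psi (sh (phi2 y)).
pose O := U2 `&` phi2 @^-1` (sh @^-1` (V' `&` V1)).
have EO y : O y -> E (tau y).
  by move=> [U2y [V'y _]]; apply: V'E => //; exact/Hsh/H2.
have tauK y : O y -> U1 (tau y) /\ phi1 (tau y) = sh (phi2 y).
  by move=> [U2y [_ V1y]]; apply: psiU => //; exact/Hsh/H2.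
exists O, (e \o tau); split.
  by split => //; split => /=; rewrite /sh -/b subrr add0r.
split.
- apply: chart_preimage_open ch2 _.
  apply: open_comp => [v _|]; first exact: csh.
  exact: openI.
- move=> y /set_mem Oy.
  apply: continuous_comp; last by apply: ce; exact/mem_set/EO.
  have [U2y [_ V1y]] := Oy.
  move=> N; rewrite nbhsE => -[N' [oN' N'y] N'N].
  have [A [oA Ay AN]] := cpsi _ _ V1y (Hsh _ (H2 _ U2y)) oN' N'y.
  have nU2 : nbhs y U2 by apply: open_nbhs_nbhs.
  have cy : {for y, continuous (sh \o phi2)}.
    by apply: continuous_comp; [exact/c2/mem_set | exact: csh].
  have nA : nbhs y ((sh \o phi2) @^-1` A).
    by apply: cy; exact: open_nbhs_nbhs.
  apply: filterS (filterI nU2 nA) => z [U2z Az]; apply: N'N; apply: AN => //.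
  exact/Hsh/H2.
- move=> y z /set_mem Oy /set_mem Oz /= eyz.
  have tyz : tau y = tau z by apply: ie eyz; exact/mem_set/EO.
  have : sh (phi2 y) = sh (phi2 z).
    by rewrite -(tauK _ Oy).2 tyz (tauK _ Oz).2.
  move=> /addIr /addIr pyz.
  by case: Oy => U2y _; case: Oz => U2z _; apply: i2 pyz; exact: mem_set.
- move=> A oA AO.
  have [A' oA' AE] := o2 A oA (fun y Ay => (AO y Ay).1).
  pose sh' (v : V) : V := v - a + b.
  have csh' : continuous sh'.
    by move=> v; exact: (cvgD (cvgB cvg_id (cvg_cst _)) (cvg_cst _)).
  have tauA : tau @` A = U1 `&` phi1 @^-1` (sh' @^-1` A').
    apply/seteqP; split => [_ [y Ay <-]|x [U1x A'x]].
      have [U1y e1] := tauK _ (AO _ Ay); split => //=.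
      rewrite e1 /sh /sh' addrK subrK.
      have : (A' `&` half_space (n:=n)) (phi2 y) by rewrite -AE; exists y.
      by case.
    have [_ H1x psix] := psiK _ U1x.
    have : (A' `&` half_space (n:=n)) (sh' (phi1 x)).
      split => //; rewrite /half_space /= /sh' !mxE a0 b0 subr0 addr0.
      exact: H1x.
    rewrite -AE => -[y Ay yE]; exists y => //.
    by rewrite /tau yE /sh /sh' addrK subrK.
  have otA : open (tau @` A).
    rewrite tauA; apply: chart_preimage_open ch1 _.
    by apply: open_comp => // v _; exact: csh'.
  have [|A'' oA'' A''E] := oe _ otA.
    by move=> _ [y Ay <-]; apply: EO; exact: AO.
  by exists A'' => //; rewrite -A''E image_comp.
Qed.

End HalfSpaceCharts.

(** * Collar charts of a bordism *)

Section SetHeight.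
Context {R : realType} {n : nat}.
Local Notation V := 'rV[R]_n.+1.

Definition set_height (v : V) (c : R) : V := v + (c - v 0 0) *: delta_mx 0 0.

Lemma set_height0 v c : set_height v c 0 0 = c.
Proof. by rewrite /set_height !mxE !eqxx mulr1 addrC subrK. Qed.

Lemma set_heightE v c j : j != 0 -> set_height v c 0 j = v 0 j.
Proof. by move=> j0; rewrite /set_height !mxE eqxx (negbTE j0) mulr0 addr0. Qed.

Lemma set_height_id v : set_height v (v 0 0) = v.
Proof. by rewrite /set_height subrr scale0r addr0. Qed.

Lemma set_heightK v c d : set_height (set_height v c) d = set_height v d.
Proof.
rewrite {1}/set_height set_height0 /set_height -addrA -scalerDl.
congr (_ + _ *: _).
by ring.
Qed.

Lemma set_height_ball (p v : V) (e c : R) :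
  p 0 0 = 0 -> 0 <= c -> c < e -> ball p e v -> ball p e (set_height v c).
Proof.
move=> p0 c0 ce [e0 pv]; split => // i j; rewrite ord1.
have [->|j0] := eqVneq j 0; last by rewrite set_heightE // -(ord1 i).
by rewrite set_height0 p0 /ball /= sub0r normrN ger0_norm.
Qed.

Lemma set_height_continuous (X : topologicalType) (f : X -> V) (c : X -> R) x :
  {for x, continuous f} -> {for x, continuous c} ->
  {for x, continuous (fun y => set_height (f y) (c y))}.
Proof.
move=> cf cc; apply: cvgD => //; apply: cvgZr_tmp; apply: cvgB => //.
exact: (continuous_comp cf (@coord_continuous _ _ _ _ _ _)).
Qed.

End SetHeight.

(** The product structure is that of the half-space, transported by a chart
    [phi].  The chart has [x] on its flat part since [x] is not interior, and
    all its flat points are then boundary points by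
    [flat_interior_transfer]. *)
Lemma bd_collar_chart (R : realType) (n : nat) (W : bordism R n) (x : W) :
  bd_set W x -> exists (O : set W) (rho : R) (ht : W -> R) (sl : W -> R -> W),
    collar_chart (bd_set W) O rho ht sl /\ O x.
Proof.
move=> Bx; have [_ _ _ /(_ x) [U [phi [Ux ch]]]] := bord_mfd W.
have [psi [V [oV psiU psiK cpsi]]] := chart_section x ch.
have H0 w : U w -> 0 <= phi w 0 0 by move=> /psiK [_ Hw _].
have bd0 w : U w -> bd_set W w -> phi w 0 0 = 0.
  move=> Uw Bw; apply/eqP; rewrite eq_le H0 // andbT leNgt; apply/negP => w0.
  exact/Bw/(half_chart_interior ch Uw w0).
have x0 := bd0 _ Ux Bx.
have bdE w : U w -> phi w 0 0 = 0 <-> bd_set W w.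
  move=> Uw; split; last exact: bd0.
  move=> w0 iw; apply: Bx.
  exact: (flat_interior_transfer ch Uw w0 ch Ux x0 iw).
have [Vx _ psix] := psiK _ Ux.
have /nbhs_ballP [rho /= rho0 rhoV] : nbhs (phi x) V by exact: open_nbhs_nbhs.
pose O := U `&` phi @^-1` ball (phi x) rho.
have slP w c : O w -> 0 <= c -> c < rho ->
    [/\ U (psi (set_height (phi w) c)),
        phi (psi (set_height (phi w) c)) = set_height (phi w) c &
        ball (phi x) rho (set_height (phi w) c)].
  move=> [Uw pw] c0 cr; have bw := set_height_ball x0 c0 cr pw.
  have [] := psiU _ (rhoV _ bw) _ => //.
  by rewrite /half_space /= set_height0.
exists O, rho, (fun w => phi w 0 0), (fun w c => psi (set_height (phi w) c)).
have [oU cphi _ _] := ch.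
split; last by split => //; exact: ballxx.
split => //.
- apply: chart_preimage_open ch _; exact: ball_open.
- move=> w [Uw _].
  exact: (continuous_comp (cphi _ (mem_set Uw))
    (@coord_continuous _ _ _ _ _ _)).
- by move=> w [/H0].
- move=> w [Uw [_ /(_ 0 0)]]; rewrite /ball /= x0 sub0r normrN => h.
  by apply: le_lt_trans h; exact: ler_norm.
- by move=> w [/bdE].
- move=> w c Ow c0 cr; have [Us e b] := slP _ _ Ow c0 cr.
  by split; rewrite /= ?e.
- move=> w c Ow c0 cr; have [Us -> b] := slP _ _ Ow c0 cr.
  by rewrite set_height0.
- move=> w c d Ow c0 cr d0 dr; have [Us -> b] := slP _ _ Ow c0 cr.
  by rewrite set_heightK.
- by move=> w [Uw _]; rewrite set_height_id; have [] := psiK _ Uw.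
- move=> w c [Uw pw] cr.
  have m0 t : 0 <= Num.max 0 t :> R by rewrite le_max lexx.
  have mr : Num.max 0 c < rho by rewrite gt_max rho0.
  have bw := set_height_ball x0 (m0 c) mr pw.
  have Hs v t : half_space (set_height v (Num.max 0 t) : 'rV[R]_n.+1).
    by rewrite /half_space /= set_height0.
  move=> N; rewrite nbhsE => -[N' [oN' N'y] N'N].
  have [A [oA Ay AN]] := cpsi _ _ (rhoV _ bw) (Hs _ _) oN' N'y.
  have c1 : {for (w, c), continuous (fun z : W * R => phi z.1)}.
    apply: (@continuous_comp _ _ _ fst phi (w, c)); first exact: cvg_fst.
    exact/cphi/mem_set.
  have c2 : {for (w, c), continuous (fun z : W * R => Num.max 0 z.2)}.
    apply: (@continuous_max _ _ (fun=> 0) (fun z : W * R => z.2)).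
      exact: cst_continuous.
    exact: cvg_snd.
  have nA : nbhs (w, c) [set z | A (set_height (phi z.1) (Num.max 0 z.2))].
    exact: set_height_continuous c1 c2 _ (open_nbhs_nbhs (conj oA Ay)).
  by apply: filterS nA => z Az; apply: N'N; exact: AN.
Qed.

(** * Extending isotopies of the boundary of a bordism *)

(** The isotopy moves [x] along a path, which is connected. *)
Lemma isotopy_preserves_clopen (R : realType) (X : topologicalType)
    (phi : X -> X) (C : set X) (x : X) :
  isotopic_to_id R phi -> open C -> closed C -> C x -> C (phi x).
Proof.
move=> [h [ch _ h0 h1]] oC cC Cx.
have c : {within `[(0 : R), 1]%classic, continuous (fun t : R => h t x)}.
  apply/subspace_continuousP => t; rewrite /= in_itv /= => t01.
  move/subspace_continuousP: ch => /(_ (t, x) t01) ch.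
  move=> U /ch [[V1 V2] /= [nV1 nV2] V12].
  change (nbhs t [set u | `[(0 : R), 1]%classic u -> U (h u x)]).
  apply: filterS nV1 => u V1u; rewrite /= in_itv /= => u01.
  by apply: (V12 (u, x)) => //; split => //; exact: nbhs_singleton.
have := connected_continuous_connected (@segment_connected R 0 1) c.
set I := _ @` _ => cI.
have hI t : 0 <= t <= 1 -> I (h t x).
  by move=> t01; exists t => //=; rewrite in_itv.
have /cI CI : (I `&` C) !=set0.
  exists x; split => //; rewrite -{1}[x]/(id x) -h0.
  by apply: hI; rewrite lexx ler01.
have : (I `&` C) (h 1 x).
  by rewrite CI; [apply: hI; rewrite lexx ler01 | exists C | exists C].
by rewrite h1; case.
Qed.

Section BordismExtension.
Context {R : realType} {n : nat} (W : bordism R n).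

Lemma bord_boundary_clopen (A A' : set W) :
  compact A -> compact A' -> A `|` A' = bd_set W -> A `&` A' = set0 ->
  open (bd_incl W @^-1` A) /\ closed (bd_incl W @^-1` A).
Proof.
have [hW _ _ _] := bord_mfd W.
have pc C : compact C -> closed (bd_incl W @^-1` C).
  move=> cC; apply: preimage_closed => [w _|]; last exact: compact_closed.
  exact: set_val_continuous.
move=> cA cA' AA' A0; split; last exact: pc.
rewrite (_ : _ @^-1` A = ~` (bd_incl W @^-1` A')).
  by apply: closed_openC; exact: pc.
apply/seteqP; split => b /=.
  by move=> Ab A'b; rewrite -[False]/(set0 (bd_incl W b)) -A0.
have : (A `|` A') (bd_incl W b) by rewrite AA'; exact: set_valP.
by case.
Qed.

(** [Phi] maps each of the incoming and outgoing boundary into itself by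
    [isotopy_preserves_clopen]; it does so surjectively since the preimage
    under [phi] of an incoming point cannot be outgoing, and conversely. *)
Lemma bd_isotopy_extension (phi : bd_mfd W -> bd_mfd W) :
  homeomorphism phi -> isotopic_to_id R phi ->
  exists Phi : W -> W, bord_homeomorphism Phi /\
    Phi \o bd_incl W = bd_incl W \o phi.
Proof.
move=> [g [_ gK _ _]] iphi; have [hW _ cptW _] := bord_mfd W.
have [Phi [hPhi PhiE]] := isotopy_extension hW cptW (@closed_bd_set _ _ W)
  (@bd_collar_chart _ _ W) iphi.
have [_ _ /compact_of_set_type ci _] := bord_in_closed W.
have [_ _ /compact_of_set_type co _] := bord_out_closed W.
have io : bord_in W `|` bord_out W = bd_set W by exact: bord_bdE.
have oi : bord_out W `|` bord_in W = bd_set W by rewrite setUC.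
have io0 := bord_in_out W.
have oi0 : bord_out W `&` bord_in W = set0 by rewrite setIC.
have image (A A' : set W) : compact A -> compact A' ->
    A `|` A' = bd_set W -> A `&` A' = set0 -> Phi @` A = A.
  move=> cA cA' AA' A0; have A'A : A' `|` A = bd_set W by rewrite setUC.
  have A'0 : A' `&` A = set0 by rewrite setIC.
  have [oA clA] := bord_boundary_clopen cA cA' AA' A0.
  have [oA' clA'] := bord_boundary_clopen cA' cA A'A A'0.
  apply/seteqP; split => [_ [w Aw <-]|w Aw].
    have [b bE] : exists b : bd_mfd W, bd_incl W b = w.
      by apply: in_bd; rewrite -AA'; left.
    rewrite -bE PhiE; apply: (isotopy_preserves_clopen iphi oA clA).
    by rewrite /= bE.
  have [b bE] : exists b : bd_mfd W, bd_incl W b = w.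
    by apply: in_bd; rewrite -AA'; left.
  exists (bd_incl W (g b)); last by rewrite PhiE gK.
  have : (A `|` A') (bd_incl W (g b)) by rewrite AA'; exact: set_valP.
  case=> // A'gb; have := isotopy_preserves_clopen iphi oA' clA' A'gb.
  rewrite gK /= bE => A'w.
  by have : (A `&` A') w by []; rewrite A0.
exists Phi; split; last by apply/funext => b; exact: PhiE.
split => //; first exact: (image _ _ ci co io io0).
exact: (image _ _ co ci oi oi0).
Qed.

End BordismExtension.

(** * Invariance of the state sum *)

(** The image points [e j] partition the index type into singletons. *)
Lemma csum_reindex (M : completeMonoidType) (I J : Type) (e : J -> I)
    (m : I -> M) : bijective e -> csum (m \o e) = csum m.
Proof.
move=> [e' eK e'K].
rewrite -(@csum_partition M I J (fun j => [set e j]) m); first last.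
- by apply/seteqP; split => // i _; exists (e' i) => //=; rewrite e'K.
- by move=> i j _ _ [_ [-> /(can_inj eK)]].
congr csum; apply/funext => j /=.
have ej : [set e j] (e j) by [].
rewrite (csum_single _ _ (SigSub (mem_set ej))) // => i.
by apply: val_inj => /=; exact: set_valP i.
Qed.

Lemma state_sum_pullM (R : realType) (n : nat) (S : completeSemiRingType)
    (C : strictMonCat) (F : fieldSystem R n) (T : actionExponentials C F)
    (W : bordism R n) (phi : bd_mfd W -> bd_mfd W) (h : homeomorphism phi)
    (Phi : W -> W) (hPhi : bord_homeomorphism Phi)
    (PhiE : Phi \o bd_incl W = bd_incl W \o phi) (f : FM F (bd_mfd W)) :
  state_sum S T W (pullM h f) = state_sum S T W f.
Proof.
have res (G : FW F W) : restrict_bd (pullW hPhi G) = pullM h (restrict_bd G).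
  exact: pull_resWM.
have ipull := bij_inj (@pullM_bij _ _ F _ _ _ h).
have [k pK kK] := @pullW_bij _ _ F _ _ _ hPhi.
pose e (G : {G : FW F W | restrict_bd G = f}) :
    {G : FW F W | restrict_bd G = pullM h f} :=
  exist _ (pullW hPhi (sval G)) (etrans (res _) (congr1 (pullM h) (svalP G))).
have kP (G : {G : FW F W | restrict_bd G = pullM h f}) :
    restrict_bd (k (sval G)) = f.
  by apply: ipull; rewrite -res kK (svalP G).
have e_bij : bijective e.
  exists (fun G => exist _ (k (sval G)) (kP G)) => G;
    apply: eq_sig_hprop => [? ? ?|]; try exact: Prop_irrelevance.
    exact: pK.
  exact: kK.
rewrite /state_sum -(csum_reindex _ e_bij); congr csum; apply/funext => G /=.
by rewrite TT_homeo.
Qed.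

Theorem proposition6p5 (R : realType) (n : nat) (S : completeSemiRingType)
    (C : strictMonCat) (F : fieldSystem R n) (T : actionExponentials C F)
    (W : bordism R n) :
  (forall (phi : bd_mfd W -> bd_mfd W) (h : homeomorphism phi),
     isotopic_to_id R phi ->
     forall f : FM F (bd_mfd W),
       state_sum S T W (pullM h f) = state_sum S T W f) /\
  state_module S C F (bd_mfd W) (state_sum S T W).
Proof.
have main (phi : bd_mfd W -> bd_mfd W) (h : homeomorphism phi) :
    isotopic_to_id R phi -> forall f : FM F (bd_mfd W),
      state_sum S T W (pullM h f) = state_sum S T W f.
  move=> iphi f; have [Phi [hPhi PhiE]] := bd_isotopy_extension h iphi.
  exact: (state_sum_pullM S T h hPhi PhiE).
by split => // phi h iphi f; exact: main.
Qed.
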